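(* A partial function $f:\mathbb{R}\to\mathbb{R}$ is infinite time computable if and only if it is computable by a one-tape infinite time Turing machine augmented with a one-cell scratch pad.
   Context: $\mathbb{R}=2^\omega$. An infinite time Turing machine (ITTM) has three tapes (input, scratch, output) of cells indexed by $\omega$ with values in $\{0,1\}$, one head scanning a column of all three tapes, and a program with finitely many states including start, halt and a limit state. Successor steps are as for ordinary Turing machines (moving left from the leftmost cell leaves the head in place); at limit stages the head returns to the leftmost cell, the state becomes the limit state, and each cell takes the $\limsup$ of its earlier values. On input $a$, $a$ is on the input tape and other tapes are $0$; upon halting the output is the output tape. $f$ is computable if some program on input $a$ halts iff $a\in\mathrm{dom}(f)$, with output $f(a)$. A one-tape ITTM with a $k$-cell scratch pad has a single tape whose cells are indexed by $\{-k,\dots,-1\}\cup\omega$, the cells $-k,\dots,-1$ forming the scratch pad; it operates like a one-tape ITTM on this tape (head starts on, and at limit stages returns to, the leftmost cell $-k$; moving left from it leaves the head in place; cells take $\limsup$ values at limits); the input $a$ is written on cells $0,1,2,\dots$ with the pad initially $0$, and upon halting the output is the contents of cells $0,1,2,\dots$ (the pad is not part of the output). *)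

(* Defs.v *)
From mathcomp Require Import all_boot.
Set Implicit Arguments. Unset Strict Implicit. Unset Printing Implicit Defensive.

(* Reals of the paper: Cantor space 2^omega. *)
Definition real2 := nat -> bool.

(* A machine with [m] tapes (tracks) sharing one head, cells indexed by nat
   (cell 0 is the leftmost cell). At each successor step the machine reads the
   [m] bits under the head, writes [m] bits, changes state and moves the head
   right ([true]) or left ([false]).  The state set is finite. *)
Record machine (m : nat) := Machine {
  mstate : finType;
  mstart : mstate;
  mhalt  : mstate;
  mlimit : mstate;
  mdelta : mstate -> ('I_m -> bool) -> mstate * ('I_m -> bool) * bool
}.

Record config (m : nat) (M : machine m) := Config {
  cstate : mstate M;
  chead  : nat;
  ctape  : 'I_m -> nat -> bool
}.

(* One successor step; moving left from cell 0 leaves the head at 0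
   (truncated subtraction). *)
Definition step (m : nat) (M : machine m) (c : config M) : config M :=
  let: (q', w, mv) := mdelta (cstate c) (fun i => ctape c i (chead c)) in
  Config q' (if mv then (chead c).+1 else (chead c).-1)
    (fun i n => if n == chead c then w i else ctape c i n).

(* A halting run from [c0] ending in [cf]: a snapshot sequence indexed by a
   well-order with a least element (time 0) and a greatest element (the halting
   time), obeying the step rule at successors and the limsup rule at limits. *)
Definition halting_run (m : nat) (M : machine m) (c0 cf : config M) : Prop :=
  exists (I : Type) (lt : I -> I -> Prop) (c : I -> config M) (z top : I),
    let succ := fun i j => lt i j /\ (forall k, ~ (lt i k /\ lt k j)) in
    well_founded lt /\
    (forall i j k, lt i j -> lt j k -> lt i k) /\
    (forall i j, lt i j \/ i = j \/ lt j i) /\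
    (forall i, i = z \/ lt z i) /\
    (forall i, i = top \/ lt i top) /\
    c z = c0 /\
    (forall i j, succ i j -> c j = step (c i)) /\
    (forall j, j <> z -> (forall i, ~ succ i j) ->
       cstate (c j) = mlimit M /\ chead (c j) = 0 /\
       (forall i n, ctape (c j) i n = true <->
          (forall k, lt k j -> exists l,
             (k = l \/ lt k l) /\ lt l j /\ ctape (c l) i n = true))) /\
    (forall i, lt i top -> cstate (c i) <> mhalt M) /\
    cstate (c top) = mhalt M /\
    c top = cf.

Definition pfun := real2 -> option real2.

Definition ittm3_start (M : machine 3) (a : real2) : config M :=
  Config (mstart M) 0 (fun i n => if nat_of_ord i == 0 then a n else false).

Definition ittm3_computes (M : machine 3) (f : pfun) : Prop :=
  forall a, match f a with
            | Some b => exists cf, halting_run (ittm3_start M a) cf /\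
                          forall n, ctape cf (@Ordinal 3 2 isT) n = b n
            | None => ~ exists cf, halting_run (ittm3_start M a) cf
            end.

Definition ittm_computable (f : pfun) : Prop :=
  exists M : machine 3, ittm3_computes M f.

(* One-tape ITTMs with a k-cell scratch pad: tape cell p (p : nat) represents
   the paper's cell p - k, so cells 0..k-1 are the pad -k..-1 and the input and
   output live on cells k, k+1, ... (the paper's 0, 1, ...). *)
Definition pad_start (k : nat) (M : machine 1) (a : real2) : config M :=
  Config (mstart M) 0 (fun _ n => if n < k then false else a (n - k)).

Definition pad_computes (k : nat) (M : machine 1) (f : pfun) : Prop :=
  forall a, match f a with
            | Some b => exists cf, halting_run (pad_start k M a) cf /\
                          forall n, ctape cf ord0 (n + k) = b n
            | None => ~ exists cf, halting_run (pad_start k M a) cf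
            end.

Definition pad_computable (k : nat) (f : pfun) : Prop :=
  exists M : machine 1, pad_computes k M f.

(* Main.v *)
Require Import Defs.
From HB Require Import structures.
From mathcomp Require Import all_boot zify.
From Stdlib Require Import Classical ClassicalEpsilon FunctionalExtensionality.
From Stdlib Require Import ProofIrrelevance PropExtensionality.
Set Implicit Arguments. Unset Strict Implicit. Unset Printing Implicit Defensive.

(** Both directions are step-by-step simulations, glued together along well-orders.

    From the pad machine to three tapes: copy the input to the output tape in omega steps,
    then run the one-tape machine there, the pad being kept on the scratch tape.

    From three tapes to the pad machine: cut the tape into blocks of five cells, so that it
    becomes a five-track tape.  The input first has to be spread out, one bit per block.
    Since a tape full of input has no spare room, each pass of omega steps frees a single
    block by shifting the rest of the input to the right, which makes omega^2 steps in all.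
    A cell flashed at the start of each pass is 0 at the end of every pass but 1 at time
    omega^2, which reveals that the last pass is over.  The three tapes are then simulated
    on three of the tracks.  Finally the output is packed again, in omega steps; the other
    flags get overwritten, and only the pad cell is left to tell the limit state
    that the computation is finished. *)

(** * Well-orders *)

Record wo := Wo {
  wcar :> Type;
  wlt : wcar -> wcar -> Prop;
  wlt_wf : well_founded wlt;
  wlt_trans : forall x y z, wlt x y -> wlt y z -> wlt x z;
  wlt_total : forall x y, wlt x y \/ x = y \/ wlt y x }.
Arguments wlt {w}.
Arguments wlt_trans {w x y z}.

Definition wle (W : wo) (x y : W) := x = y \/ wlt x y.
Definition wsucc (W : wo) (x y : W) :=
  wlt x y /\ forall k, ~ (wlt x k /\ wlt k y).
Definition wlim (W : wo) (x : W) :=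
  (exists y, wlt y x) /\ forall y, ~ wsucc y x.

Section WellOrderTheory.
Variable W : wo.
Implicit Types x y z : W.

Lemma wlt_irr x : ~ wlt x x.
Proof. by elim: x / (wlt_wf x) => x _ IH h; apply: (IH x). Qed.

Lemma wlt_asym x y : wlt x y -> ~ wlt y x.
Proof. by move=> h1 h2; apply: (@wlt_irr x); apply: wlt_trans h2. Qed.

Lemma wle_lt_trans x y z : wle x y -> wlt y z -> wlt x z.
Proof. by case=> [-> //|h1 h2]; apply: wlt_trans h2. Qed.

Lemma wlt_le_trans x y z : wlt x y -> wle y z -> wlt x z.
Proof. by move=> h [<- //|]; apply: wlt_trans. Qed.

Lemma wle_trans x y z : wle x y -> wle y z -> wle x z.
Proof. by move=> h [<- //|h2]; right; apply: wle_lt_trans h2. Qed.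

Lemma wnlt x y : ~ wlt x y -> wle y x.
Proof. by case: (wlt_total x y) => [//|[->|]] h; [left|right]. Qed.

Lemma wnle x y : ~ wle x y -> wlt y x.
Proof. by move=> h; apply: NNPP => /wnlt. Qed.

Lemma wle_nlt x y : wle x y -> ~ wlt y x.
Proof. by case=> [->|]; [apply: wlt_irr|apply: wlt_asym]. Qed.

Lemma wleast (P : W -> Prop) :
  (exists x, P x) -> exists x, P x /\ forall y, P y -> wle x y.
Proof.
case=> x; elim: x / (wlt_wf x) => x _ IH Px.
case: (classic (exists y, P y /\ wlt y x)) => [[y [Py yx]]|no]; first exact: IH yx Py.
by exists x; split=> // y Py; apply: wnlt => yx; apply: no; exists y.
Qed.

Lemma wsucc_ex x y : wlt x y -> exists z, wsucc x z /\ wle z y.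
Proof.
move=> xy; have [z [xz zl]] := wleast (ex_intro (wlt x) y xy).
by exists z; split; [split=> // k [xk kz]; case: (wle_nlt (zl k xk))|apply: zl].
Qed.

Lemma wlim_succ x y : wlim x -> wlt y x -> exists z, wsucc y z /\ wlt z x.
Proof.
move=> [_ nx] /wsucc_ex[z [yz [zx|zx]]]; last by exists z.
by case: (nx y); rewrite -zx.
Qed.

Lemma wcases x : (forall y, ~ wlt y x) \/ (exists y, wsucc y x) \/ wlim x.
Proof.
case: (classic (exists y, wlt y x)) => h; last by left=> y yx; apply: h; exists y.
right; case: (classic (exists y, wsucc y x)) => h'; first by left.
by right; split=> // y yx; apply: h'; exists y.
Qed.

(** The clause [G] sees a total function, which avoids dependent types. [body] fills in the default
    [t0] outside the predecessors, and the locality hypothesis makes these values irrelevant. *)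
Lemma wf_recursion (T : Type) (t0 : T) (G : W -> (W -> T) -> T) :
  (forall i g h, (forall j, wlt j i -> g j = h j) -> G i g = G i h) ->
  exists f, forall i, f i = G i f.
Proof.
move=> loc.
pose body i (rec : forall j, wlt j i -> T) := G i (fun j =>
  match excluded_middle_informative (wlt j i) with
  | left h => rec j h | right _ => t0 end).
exists (Fix (@wlt_wf W) (fun _ => T) body) => i.
rewrite Fix_eq.
  by apply: loc => j ji; case: (excluded_middle_informative _).
move=> x f g fg; apply: loc => j jx.
by case: (excluded_middle_informative _) => //.
Qed.

End WellOrderTheory.

(** * Constructions of well-orders: initial segments and ordinal sums *)

Lemma nat_wf : well_founded (fun m n : nat => m < n).
Proof.
move=> n; elim/ltn_ind: n => n IH; constructor=> m mn; exact: IH.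
Qed.
Definition wo_nat : wo.
Proof. by refine (@Wo nat (fun m n => m < n) nat_wf _ _); lia. Defined.

Definition wo_unit : wo.
Proof.
refine (@Wo unit (fun _ _ => False) _ _ _); [by move=> x; constructor=> y []|by []|].
by case=> -[]; right; left.
Defined.

Section Subtype.
Variables (W : wo) (P : W -> Prop).
Definition sub_lt (x y : {i | P i}) := wlt (proj1_sig x) (proj1_sig y).
Lemma sub_wf : well_founded sub_lt.
Proof.
move=> [x px]; elim: x / (wlt_wf x) px => x _ IH px.
constructor=> -[y py] /= yx; exact: IH.
Qed.
Lemma sub_trans x y z : sub_lt x y -> sub_lt y z -> sub_lt x z.
Proof. exact: wlt_trans. Qed.
Lemma sub_total x y : sub_lt x y \/ x = y \/ sub_lt y x.
Proof.
case: x y => [x px] [y py]; rewrite /sub_lt /=.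
have [h|[h|h]] := wlt_total x y; [by left|right; left|by right; right].
by subst y; congr exist; apply: proof_irrelevance.
Qed.
Definition wo_sub := Wo sub_wf sub_trans sub_total.
End Subtype.

Section Sum.
Variables A B : wo.
Definition sum_lt (x y : A + B) : Prop := match x, y with
  | inl a, inl b => wlt a b | inr a, inr b => wlt a b
  | inl _, inr _ => True | inr _, inl _ => False end.
Lemma sum_wf : well_founded sum_lt.
Proof.
have L a : Acc sum_lt (inl a).
  elim: a / (wlt_wf a) => a _ IH; constructor=> -[b ba|b []]; exact: IH.
case=> [b|b]; first exact: L.
elim: b / (wlt_wf b) => b _ IH; constructor=> -[c _|c cb]; [exact: L|exact: IH].
Qed.
Lemma sum_trans x y z : sum_lt x y -> sum_lt y z -> sum_lt x z.
Proof. by case: x y z => [a|a] [b|b] [c|c] //=; apply: wlt_trans. Qed.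
Lemma sum_total x y : sum_lt x y \/ x = y \/ sum_lt y x.
Proof.
case: x y => [a|a] [b|b] /=; [|by left|by right; right|];
by have [h|[->|h]] := wlt_total a b; [left|right; left|right; right].
Qed.
Definition wo_sum := Wo sum_wf sum_trans sum_total.
End Sum.

Section Sigma.
Variables (A : wo) (B : A -> wo).
(** The blocks [B a] are laid end to end along [A]. Elements of one block are compared after
    transport along the equality of their indices. *)
Definition sig_lt (p q : {a : A & B a}) : Prop :=
  wlt (projT1 p) (projT1 q) \/
  exists e : projT1 p = projT1 q,
    wlt (eq_rect _ (fun a => B a) (projT2 p) _ e) (projT2 q).
Lemma sig_lt_snd a (x y : B a) :
  sig_lt (existT _ a x) (existT _ a y) <-> wlt x y.
Proof.
split=> [[/wlt_irr //|[e]]|h] /=; last by right; exists erefl.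
by rewrite (proof_irrelevance _ e erefl).
Qed.
Lemma sig_wf : well_founded sig_lt.
Proof.
case=> a; elim: a / (wlt_wf a) => a _ IH x; elim: x / (wlt_wf x) => x _ IHx.
constructor=> -[b y] [/= ba|/= [e yx]]; first exact: IH.
subst b; exact: IHx.
Qed.
Lemma sig_trans x y z : sig_lt x y -> sig_lt y z -> sig_lt x z.
Proof.
case: x y z => [a x] [b y] [c z] [/= ab|/= [e h1]] [/= bc|/= [e' h2]];
  try subst b; try subst c; try by left=> //=.
- by left; apply: wlt_trans bc.
- by apply/sig_lt_snd; apply: wlt_trans h2.
Qed.
Lemma sig_total x y : sig_lt x y \/ x = y \/ sig_lt y x.
Proof.
case: x y => [a x] [b y].
have [h|[h|h]] := wlt_total a b; [by left; left| |by right; right; left].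
subst b; have [h|[->|h]] := wlt_total x y; [left|by right; left|right; right];
by apply/sig_lt_snd.
Qed.
Definition wo_sigma := Wo sig_wf sig_trans sig_total.
End Sigma.

(** * Transfinite runs *)

Definition wmono (I J : wo) (g : I -> J) := forall i i', wlt i i' -> wlt (g i) (g i').
Definition winitial (I J : wo) (h : I -> J) :=
  wmono h /\ forall i j, wlt j (h i) -> exists2 i', wlt i' i & j = h i'.

Lemma wmono_inv (I J : wo) (g : I -> J) i i' : wmono g -> wlt (g i) (g i') -> wlt i i'.
Proof.
move=> gm h; have [//|[e|/gm h']] := wlt_total i i'.
- by rewrite e in h; case: (wlt_irr h).
- by case: (wlt_asym h).
Qed.

(* h i is the least element above all h i' with i' < i; it exists since it never exceeds g i. *)
Lemma winitial_ex (I J : wo) (g : I -> J) : wmono g -> exists h : I -> J, winitial h.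
Proof.
move=> gm; case: (classic (exists i : I, True)) => [[i0 _]|no]; last first.
  by exists g; split=> // i; case: no; exists i.
pose least i (h : I -> J) j :=
  (forall i', wlt i' i -> wlt (h i') j) /\
  forall j', (forall i', wlt i' i -> wlt (h i') j') -> wle j j'.
have [|h hE] := @wf_recursion I J (g i0)
  (fun i h => epsilon (inhabits (g i0)) (least i h)).
  move=> i f f' ff'; congr epsilon; apply: functional_extensionality => j.
  have E j' : (forall i', wlt i' i -> wlt (f i') j') = (forall i', wlt i' i -> wlt (f' i') j').
    apply: propositional_extensionality.
    by split=> H i' ii; move: (H i' ii); rewrite ff'.
  rewrite /least E; congr (_ /\ _).
  by apply: propositional_extensionality; split=> H j'; move: (H j'); rewrite E.
have hle : forall i, least i h (h i) /\ wle (h i) (g i).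
  move=> i; elim: i / (wlt_wf i) => i _ IH.
  have P : forall i', wlt i' i -> wlt (h i') (g i).
    by move=> i' ii; apply: wle_lt_trans (proj2 (IH _ ii)) _; apply: gm.
  have L : least i h (h i).
    rewrite hE; apply: epsilon_spec.
    have [j [Pj jl]] := wleast (ex_intro (fun j => forall i', wlt i' i -> wlt (h i') j) (g i) P).
    by exists j.
  by split=> //; apply: (proj2 L).
exists h; split=> [i i' ii|i].
  exact: (proj1 (proj1 (hle i'))).
elim: i / (wlt_wf i) => i _ IH j ji.
have [i' [ii' ji']] : exists i', wlt i' i /\ wle j (h i').
  apply: NNPP => no; have /(wle_nlt)[]// : wle (h i) j.
  apply: (proj2 (proj1 (hle i))) => i' ii'; apply: wnle => H.
  by apply: no; exists i'.
case: ji' => [->|/(IH _ ii')[i2 h1 ->]]; first by exists i'.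
by exists i2 => //; apply: wlt_trans ii'.
Qed.

Lemma sub_initial (W : wo) (P : W -> Prop) :
  (forall i j, wlt i j -> P j -> P i) ->
  winitial (fun x : wo_sub P => proj1_sig x : W).
Proof.
move=> dc; split=> // [[i pi]] j /= ji.
by exists (exist _ j (dc _ _ ji pi)).
Qed.

Section Runs.
Variables (m : nat) (M : machine m).
Implicit Types (W : wo) (c d : config M) (V : config M -> Prop).

Definition limsup_below W (r : W -> config M) (j : W) (i : 'I_m) (n : nat) : Prop :=
  forall k, wlt k j -> exists l, wle k l /\ wlt l j /\ ctape (r l) i n = true.

Definition is_limit_of W (r : W -> config M) (j : W) c :=
  [/\ cstate c = mlimit M, chead c = 0
    & forall i n, ctape c i n = true <-> limsup_below r j i n].

Record is_run W (r : W -> config M) c0 : Prop := IsRun {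
  run0 : forall i, (forall j, ~ wlt j i) -> r i = c0;
  runS : forall i j, wsucc i j -> r j = step (r i);
  runL : forall j, wlim j -> is_limit_of r j (r j) }.

Lemma config_eq c d : cstate c = cstate d -> chead c = chead d ->
  (forall i n, ctape c i n = ctape d i n) -> c = d.
Proof.
case: c d => [q h t] [q' h' t'] /= -> -> e; congr Config.
by do 2 apply: functional_extensionality => ?.
Qed.

Lemma limit_unique W (r r' : W -> config M) j c d :
  (forall i, wlt i j -> r i = r' i) ->
  is_limit_of r j c -> is_limit_of r' j d -> c = d.
Proof.
move=> e [c1 c2 c3] [d1 d2 d3]; apply: config_eq; rewrite ?c1 ?c2 //.
have E i n : limsup_below r j i n <-> limsup_below r' j i n.
  by split=> h k /h[l [kl [lj hl]]]; exists l; split=> //; split=> //; rewrite ?e // -e.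
by move=> i n; apply/idP/idP => [/c3/E/d3|/d3/E/c3].
Qed.

(** By recursion on time: step from the predecessor, which is unique by totality; take limsups at
    limits; start from [c0] at the least index. Propositions become bits by excluded middle. *)
Lemma run_exists W c0 : exists r : W -> config M, is_run r c0.
Proof.
pose dec P := if excluded_middle_informative P then true else false.
have decP P : dec P = true <-> P by rewrite /dec; case: excluded_middle_informative.
pose lim r (j : W) := Config (mlimit M) 0 (fun i n => dec (limsup_below r j i n)).
have limP r j : is_limit_of r j (lim r j) by split=> // i n /=; apply: decP.
pose G (i : W) (r : W -> config M) :=
  if dec (exists j, wsucc j i) then step (r (epsilon (inhabits i) (fun j => wsucc j i)))
  else if dec (exists j, wlt j i) then lim r i else c0.
have GS i j r : wsucc j i -> G i r = step (r j).
  move=> ji; have ex : exists j, wsucc j i by exists j.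
  rewrite /G (proj2 (decP _) ex).
  have := epsilon_spec (inhabits i) (fun j => wsucc j i) ex.
  set e := epsilon _ _ => -[e1 e2]; case: ji => j1 j2.
  have [h|[-> //|h]] := wlt_total e j; [by case: (e2 j)|by case: (j2 e)].
have GL i r : wlim i -> G i r = lim r i.
  case=> e ns; rewrite /G (proj2 (decP _) e).
  by case: ifP => // /decP[j /ns].
have G0 i r : (forall j, ~ wlt j i) -> G i r = c0.
  move=> no; rewrite /G; case: ifP => [/decP[j [/no]]|_] //.
  by case: ifP => [/decP[j /no]|_].
have [|r rE] := @wf_recursion W (config M) c0 G.
  move=> i g h gh; have [no|[[j ji]|li]] := wcases i.
  - by rewrite !G0.
  - by rewrite !(GS _ _ _ ji) gh //; case: ji.
  - by rewrite !GL //; apply: limit_unique gh (limP _ _) (limP _ _).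
exists r; split=> [i no|i j ij|j lj].
- by rewrite rE G0.
- by rewrite [LHS]rE (GS _ _ _ ij).
- by rewrite [X in is_limit_of r j X]rE GL.
Qed.

Lemma run_unique W (r r' : W -> config M) c0 :
  is_run r c0 -> is_run r' c0 -> forall i, r i = r' i.
Proof.
move=> R R' i; elim: i / (wlt_wf i) => i _ IH.
have [no|[[j ji]|li]] := wcases i.
- by rewrite (run0 R no) (run0 R' no).
- by rewrite (runS R ji) (runS R' ji) IH //; case: ji.
- exact: limit_unique IH (runL R li) (runL R' li).
Qed.

(** Such an [h] sends successors to successors and limits to limits. Every index below [h j] has the
    form [h i], so the limsup at [h j] is the same before and after pulling back. *)
Lemma run_initial (I J : wo) (h : I -> J) (r : J -> config M) c0 :
  winitial h -> is_run r c0 -> is_run (fun i => r (h i)) c0.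
Proof.
move=> [hm hi] R.
have hS i j : wsucc i j -> wsucc (h i) (h j).
  move=> [ij no]; split=> [|k [ik kj]]; first exact: hm.
  have [k' k'j e] := hi _ _ kj; apply: (no k'); split=> //.
  by rewrite e in ik; apply: wmono_inv ik.
split=> [i no|i j /hS ij|j [[i ij] ns]].
- by apply: (run0 R) => j /hi[i' /no].
- exact: (runS R).
have /(runL R)[h1 h2 h3] : wlim (h j).
  split; first by exists (h i); apply: hm.
  move=> k [kj no]; have [k' k'j e] := hi _ _ kj; apply: (ns k'); split=> // l [kl lj].
  by apply: (no (h l)); rewrite e; split; apply: hm.
split=> // t n; apply: (iff_trans (h3 t n)); split=> H k kj.
  have [l [kl [lj hl]]] := H _ (hm _ _ kj).
  have [l' l'j e] := hi _ _ lj; exists l'; split; last by rewrite -e.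
  apply: wnlt => /hm; rewrite -e => lk; exact: (wle_nlt kl).
have [k' k'j e] := hi _ _ kj; have [l [kl [lj hl]]] := H _ k'j.
exists (h l); split; last by split=> //; apply: hm.
by rewrite e; case: kl => [->|/hm ?]; [left|right].
Qed.

(** From [g] one gets an embedding onto an initial segment; along it [s] pulls back to a run, which
    is [r] by uniqueness. So a longer run meets whatever a shorter one meets. *)
Lemma run_compare (I J : wo) (g : I -> J) (r : I -> config M) (s : J -> config M) c0 :
  wmono g -> is_run r c0 -> is_run s c0 -> forall i, exists j, r i = s j.
Proof.
move=> /winitial_ex[h hi] R S i; exists (h i).
exact: (run_unique R (run_initial hi S)).
Qed.

(** At least one stage passes, possibly transfinitely many; [V] constrains everything from [c] on,
    but not the end point [d]. *)
Definition seg V c d := exists W (r : W -> config M) (t : W),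
  [/\ is_run r c, r t = d, exists z, wlt z t & forall i, wlt i t -> V (r i)].

(* A segment without its end point; [d] is the configuration that has to follow it, if any. *)
Record piece V c (d : option (config M)) := Piece {
  pc_wo : wo;
  pc_run : pc_wo -> config M;
  pc_min : pc_wo;
  pc_minP : forall x, wle pc_min x;
  pc_runP : is_run pc_run c;
  pc_V : forall i, V (pc_run i);
  pc_max : forall e t, d = Some e -> (forall y, wle y t) -> e = step (pc_run t);
  pc_lim : forall e, d = Some e -> (forall t, exists y : pc_wo, wlt t y) ->
    [/\ cstate e = mlimit M, chead e = 0 & forall i n, ctape e i n = true <->
      forall k, exists l, wle k l /\ ctape (pc_run l) i n = true] }.

Lemma piece_trivial V c : V c -> inhabited (piece V c None).
Proof.
move=> Vc; apply: inhabits; apply: (@Piece V c None wo_unit (fun=> c) tt) => //.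
- by case; left.
- by split=> // [i j []|j [[i []]]].
Qed.

(** The run is cut just before [t]. If what remains has a last index, [t] is its successor;
    otherwise [t] is a limit. *)
Lemma piece_seg V c d : seg V c d -> inhabited (piece V c (Some d)).
Proof.
move=> [W [r [t [R rt tz Vr]]]].
have hi : winitial (fun x : wo_sub (fun i : W => wlt i t) => proj1_sig x : W).
  by apply: sub_initial => i j; apply: wlt_trans.
have [z [zt zl]] := wleast tz.
apply: inhabits; apply: (@Piece V c (Some d) (wo_sub (fun i : W => wlt i t))
  (fun x => r (proj1_sig x)) (exist _ z zt)).
- move=> [x xt]; have [e|h] := zl _ xt; last by right.
  by left; subst x; congr exist; apply: proof_irrelevance.
- exact: run_initial hi R.
- by move=> [x xt]; apply: Vr.
- move=> e [x xt] [<-] xm /=; rewrite -rt; apply: (runS R); split=> // k [xk kt].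
  by have /wle_nlt := xm (exist _ k kt); apply.
- move=> e [<-] nomax; rewrite -rt.
  have /(runL R)[h1 h2 h3] : wlim t.
    split=> // y [yt no]; have [[k kt] /= yk] := nomax (exist _ y yt).
    by apply: (no k).
  split=> // i n; apply: (iff_trans (h3 i n)); split=> [H [k kt]|H k kt].
    have [l [kl [lt hl]]] := H _ kt; exists (exist _ l lt); split=> //.
    case: kl => [e'|h]; last by right.
    by left; subst l; congr exist; apply: proof_irrelevance.
  have [[l lt] [kl hl]] := H (exist _ k kt); exists l; split=> //.
  by case: kl => [[<-]|h]; [left|right].
Qed.

Lemma piece_start V c o (p : piece V c o) : pc_run (pc_min p) = c.
Proof. by apply: (run0 (pc_runP p)) => j /(wle_nlt (pc_minP j)). Qed.

(** * Gluing segments along a well-order *)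

Section RunSum.
Variables (A : wo) (f : A -> config M) (V : A -> config M -> Prop) (c0 : config M).
Hypothesis f0 : forall a, (forall b, ~ wlt b a) -> f a = c0.
Hypothesis Vf : forall a, V a (f a).
Hypothesis fS : forall a b, wsucc a b -> seg (V a) (f a) (f b).
Hypothesis fL : forall a, wlim a ->
  [/\ cstate (f a) = mlimit M, chead (f a) = 0
    & forall i n,
      (ctape (f a) i n = true -> limsup_below f a i n) /\
      (ctape (f a) i n = false -> exists2 b, wlt b a &
         forall b' y, wle b b' -> wlt b' a -> V b' y -> ctape y i n = false)].

(** [f] lists checkpoints along [A], and [V a] confines what happens from checkpoint [a] up to the
    next. The segments are laid end to end. At a limit of checkpoints it is enough to see ones at
    checkpoints, whereas a zero has to persist through the segments as well; this is what [fL]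
    provides. *)
Lemma run_sum : exists (J : wo) (r : J -> config M) (g : A -> J),
  [/\ is_run r c0, wmono g, forall a, r (g a) = f a
    & forall j, exists a, wle (g a) j /\ V a (r j)].
Proof.
have [p pS] : exists p : forall a, {o & piece (V a) (f a) o},
    forall a b, wsucc a b -> projT1 (p a) = Some (f b).
  have H a : exists p : {o & piece (V a) (f a) o}, forall b, wsucc a b -> projT1 p = Some (f b).
    case: (classic (exists b, wsucc a b)) => [[b ab]|no].
      have [p] := piece_seg (fS ab); exists (existT _ _ p) => b' ab'.
      congr (Some (f _)); case: ab ab' => [h1 h2] [h1' h2'].
      by have [h|[//|h]] := wlt_total b b'; [case: (h2' b)|case: (h2 b')].
    have [p] := piece_trivial (Vf a); exists (existT _ _ p) => b' ab'.
    by case: no; exists b'.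
  exists (fun a => proj1_sig (constructive_indefinite_description _ (H a))) => a.
  exact: proj2_sig (constructive_indefinite_description _ (H a)).
pose B a := pc_wo (projT2 (p a)); pose J := @wo_sigma A B.
pose z a : B a := pc_min (projT2 (p a)).
pose pr a (x : B a) := pc_run x.
pose el a (x : B a) : J := existT (fun a => B a) a x.
pose r (j : J) := pr _ (projT2 j).
have rz a : pr a (z a) = f a by apply: piece_start.
have zl a (x : B a) : x = z a \/ wlt (z a) x by case: (pc_minP x); [left|right].
have pR a : is_run (@pr a) (f a) by apply: pc_runP.
have fst a b (x : B a) (y : B b) : wlt a b -> wlt (el a x) (el b y) by left.
have snd a (x y : B a) : wlt (el a x) (el a y) <-> wlt x y by apply: sig_lt_snd.
have ltP (j : J) a (x : B a) : wlt j (el a x) ->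
    (exists b y, j = el b y /\ wlt b a) \/ exists y, j = el a y /\ wlt y x.
  case: j => b y [h|/= [e]]; first by left; exists b, y.
  by subst b => /= h; right; exists y.
exists J, r, (fun a => el a (z a)); split.
- split.
  + move=> [a x] no; have [e|h] := zl _ x; last by case: (no (el a (z a))); apply/snd.
    rewrite /r /= e rz; apply: f0 => b ba; apply: (no (el b (z b))); exact: fst.
  (* A successor is the first index of a piece, preceded by the last index of the piece before, or
     else it has its predecessor in its own piece. *)
  + move=> [a x] [b y] [/(@ltP _ b y)[[a' [x' [[e1 e2] ab]]]|[x' [e h]]] no].
    * subst a'; clear e2.
      have ey : y = z b.
        have [//|h] := zl _ y; case: (no (el b (z b))); split; first exact: fst.
        exact/snd.
      have xm : forall y, wle y x.
        move=> x2; apply: wnlt => h; apply: (no (el a x2)); split; last exact: fst.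
        exact/snd.
      have ab' : wsucc a b.
        by split=> // k [ak kb]; apply: (no (el k (z k))); split; apply: fst.
      by rewrite /r /= ey rz; apply: pc_max xm; apply: pS.
    * have ea : a = b by case: e.
      subst b; have {e} e : x = x' by apply: EqdepTheory.inj_pair2 e.
      subst x'; rewrite /r /=; apply: (runS (pR a)); split=> // k [xk ky].
      by apply: (no (el a k)); split; apply/snd.
  (* A limit lies inside a piece, or starts a piece whose predecessor piece has no last index, or
     starts a piece at a limit of [A]. Only the last case calls on [fL]. *)
  + move=> [a x] [[j0 j0x] ns].
    have [ex|zx] := zl _ x; last first.
      have /(runL (pR a))[h1 h2 h3] : wlim x.
        split; first by exists (z a).
        move=> y [yx no]; apply: (ns (el a y)); split=> [|k [yk /ltP]]; first exact/snd.
        case=> [[b [y' [e ba]]]|[y' [e h]]]; subst k; last by apply: (no y'); split=> //; apply/snd.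
        have h := fst _ _ y' y ba; exact: (wlt_asym yk h).
      split=> // i n; apply: (iff_trans (h3 i n)); split=> H k.
        move=> /ltP[[b [y [-> ba]]]|[y [-> /H[l [yl [lx hl]]]]]].
          have [l [zl' [lx hl]]] := H _ zx; exists (el a l); split; first by right; apply: fst.
          by split=> //; apply/snd.
        exists (el a l); split; last by split=> //; apply/snd.
        by case: yl => [->|h]; [left|right; apply/snd].
      move=> kx; have [|l [kl [lx hl]]] := H (el a k); first exact/snd.
      have [[b [y [e ba]]]|[y [e yx]]] := ltP _ _ _ lx; subst l.
        by case: (wle_nlt kl); apply: fst.
      exists y; split=> //; apply: wnlt => /snd; exact: wle_nlt kl.
    subst x; have [no|[[b ba]|la]] := wcases a.
    * have [[b [y [_ /no //]]]|[y [_ yz]]] := ltP _ _ _ j0x.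
      by have := wle_nlt (pc_minP y) yz.
    * have lb : forall j, wlt j (el a (z a)) -> exists y : B b, wle j (el b y).
        move=> j /ltP[[c [y [-> ca]]]|[y [_ yz]]]; last by have := wle_nlt (pc_minP y) yz.
        have [h|[h|h]] := wlt_total c b; [exists (z b)|subst c; exists y|].
        - by right; apply: fst.
        - by left.
        - by case: ba => _ /(_ c)[].
      have nomax : forall t : B b, exists y, wlt t y.
        move=> t; apply: NNPP => no; apply: (ns (el b t)); split; first by apply: fst; case: ba.
        move=> k [tk /lb[y ky]]; apply: no; exists y; apply/snd.
        exact: wlt_le_trans tk ky.
      have := pc_lim (pS _ _ ba) nomax; rewrite -rz /r => -[h1 h2 h3].
      split=> // i n; apply: (iff_trans (h3 i n)); split=> H k.
        move=> /lb[y ky]; have [l [yl hl]] := H y; exists (el b l); split.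
          by apply: wle_trans ky _; case: yl => [->|h]; [left|right; apply/snd].
        by split=> //; apply: fst; case: ba.
      have [|l [kl [lx hl]]] := H (el b k); first by apply: fst; case: ba.
      have [y ly] := lb _ lx; move: kl hl ly; case: l lx => c w lx kl hl ly.
      have ec : c = b.
        have [h|[//|h]] := wlt_total c b.
          by case: (wle_nlt kl); apply: fst.
        by case: (wle_nlt ly); apply: fst.
      subst c; exists w; split=> //; apply: wnlt => /snd; exact: wle_nlt kl.
    * have [h1 h2 h3] := fL la; rewrite /r /= rz; split=> // i n; split.
        move=> /(proj1 (h3 i n)) H k /ltP[[b [y [-> ba]]]|[y [_ yz]]]; last by have := wle_nlt (pc_minP y) yz.
        have [b' [bb' b'a]] := wlim_succ la ba.
        have [l [bl [lt hl]]] := H _ b'a; exists (el l (z l)); split.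
          by right; apply: fst; apply: wlt_le_trans bl; case: bb'.
        by split; [apply: fst|rewrite /= rz].
      case E: (ctape (f a) i n) => // H; have [b ba Hb] := proj2 (h3 i n) E.
      have [|l [bl [lt hl]]] := H (el b (z b)); first exact: fst.
      have [[c [w [e ca]]]|[y [_ yz]]] := ltP _ _ _ lt; last by have := wle_nlt (pc_minP y) yz.
      subst l; rewrite (Hb c) // in hl; last exact: pc_V.
      by apply: wnlt => cb; case: (wle_nlt bl); apply: fst.
- by move=> a b; apply: fst.
- by move=> a; apply: rz.
- move=> [a x]; exists a; split; last exact: pc_V.
  by have [->|h] := zl _ x; [left|right; apply/snd].
Qed.
End RunSum.
End Runs.

(** * Segments of runs, halting and simulation *)

Section Segments.
Variables (m : nat) (M : machine m).
Implicit Types (c d e : config M) (V : config M -> Prop).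

Definition running c := cstate c <> mhalt M.

Definition reach V c d := exists (W : wo) (r : W -> config M) (t : W),
  [/\ is_run r c, r t = d & forall i, wlt i t -> V (r i)].

Lemma nat_succ (i j : wo_nat) : wsucc i j -> j = i.+1.
Proof. by case=> /= ij /(_ i.+1); lia. Qed.

Lemma nat_nlim (i : wo_nat) : ~ wlim i.
Proof.
case=> -[j ji] /(_ i.-1); case; split=> [|k [/= ]]; first by move: ji => /=; lia.
by move: ji => /=; lia.
Qed.

Lemma iter_run c : @is_run _ M wo_nat (fun n => iter n (@step m M) c) c.
Proof.
split=> [i no|i j /nat_succ -> //|j /nat_nlim //].
by case: i no => // i no; case: (no 0).
Qed.

Lemma seg_iter V c k : 0 < k -> (forall j, j < k -> V (iter j (@step m M) c)) ->
  seg V c (iter k (@step m M) c).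
Proof.
move=> k0 H; exists wo_nat, (fun n => iter n (@step m M) c), k; split=> //.
- exact: iter_run.
- by exists 0.
Qed.

Lemma seg_step V c : V c -> seg V c (step c).
Proof. by move=> Vc; apply: (@seg_iter V c 1) => // -[]. Qed.

Lemma seg_start V c d : seg V c d -> V c.
Proof.
move=> [W [r [t [R _ h H]]]]; have [z [zt zl]] := wleast h.
rewrite -(run0 R (i := z)); first exact: H.
by move=> j jz; apply: (wle_nlt (zl j _) jz); apply: wlt_trans zt.
Qed.

Lemma reachE V c d : reach V c d <-> c = d \/ seg V c d.
Proof.
split=> [[W [r [t [R rt H]]]]|[<-|[W [r [t [R rt _ H]]]]]]; last by exists W, r, t.
  case: (classic (exists z, wlt z t)) => h; [right|left].
    by exists W, r, t.
  by rewrite -rt; symmetry; apply: (run0 R) => j jt; apply: h; exists j.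
exists wo_nat, (fun n => iter n (@step m M) c), 0; split=> //; exact: iter_run.
Qed.

Lemma seg_sum (A : wo) (f : A -> config M) (V : A -> config M -> Prop) U c0 t :
  (forall a, (forall b, ~ wlt b a) -> f a = c0) ->
  (forall a, V a (f a)) ->
  (forall a b, wsucc a b -> seg (V a) (f a) (f b)) ->
  (forall a, wlim a ->
    [/\ cstate (f a) = mlimit M, chead (f a) = 0
    & forall i n,
      (ctape (f a) i n = true -> limsup_below f a i n) /\
      (ctape (f a) i n = false -> exists2 b, wlt b a &
         forall b' y, wle b b' -> wlt b' a -> V b' y -> ctape y i n = false)]) ->
  (exists z, wlt z t) ->
  (forall a y, wlt a t -> V a y -> U y) ->
  seg U c0 (f t).
Proof.
move=> h0 h1 h2 h3 [z zt] HU.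
have [J [r [g [R gm rg H]]]] := run_sum h0 h1 h2 h3.
exists J, r, (g t); split=> //; first by exists (g z); apply: gm.
move=> j jt; have [a [gaj Va]] := H j; apply: HU Va.
apply: (wmono_inv gm); exact: wle_lt_trans jt.
Qed.

Lemma seg_trans V c d e : seg V c d -> seg V d e -> seg V c e.
Proof.
move=> cd de.
(* Checkpoints must be given along a whole well-order, so the list goes on with ordinary steps after
   [e]; nothing is required of that tail. *)
pose f (n : wo_nat) := match n with 0 => c | 1 => d | k.+2 => iter k (@step m M) e end.
pose V' (n : wo_nat) := if (n : nat) < 2 then V else fun=> True.
apply: (@seg_sum wo_nat f V' V c 2).
- by case=> // n no; case: (no 0).
- by case=> [|[|n]] //; [apply: seg_start cd|apply: seg_start de].
- move=> [|[|n]] b /nat_succ -> //.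
  exact: (@seg_step (V' n.+2) (iter n (@step m M) e)).
- by move=> a /nat_nlim.
- by exists 0.
- by rewrite /V' => -[|[|a]].
Qed.

Lemma seg_reach V c d e : seg V c d -> reach V d e -> seg V c e.
Proof. by move=> cd /reachE[<- //|]; apply: seg_trans. Qed.

Lemma reach_trans V c d e : reach V c d -> reach V d e -> reach V c e.
Proof. by move=> /reachE[-> //|cd] /(seg_reach cd) ce; apply/reachE; right. Qed.

Lemma reach_seg V c d e : reach V c d -> seg V d e -> seg V c e.
Proof. by move=> /reachE[-> //|]; apply: seg_trans. Qed.

Lemma reach_refl V c : reach V c c.
Proof. by apply/reachE; left. Qed.

Lemma reach_step V c d : V c -> reach V (step c) d -> reach V c d.
Proof. by move=> Vc; apply: reach_trans; apply/reachE; right; apply: seg_step. Qed.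
(** Gluing along omega plus one point, [L] being on top. Each segment may itself be transfinite,
    which allows omega passes of omega steps. *)
Lemma seg_omega (f : nat -> config M) (V : nat -> config M -> Prop) U L :
  (forall n, seg (V n) (f n) (f n.+1)) ->
  (forall n y, V n y -> U y) ->
  cstate L = mlimit M -> chead L = 0 ->
  (forall i p, if ctape L i p then forall N, exists2 n, N <= n & ctape (f n) i p
    else exists N, forall n y, N <= n -> V n y -> ctape y i p = false) ->
  seg U (f 0) L.
Proof.
move=> fS VU L1 L2 L3.
pose A := wo_sum wo_nat wo_unit.
pose F (a : A) := match a with inl n => f n | inr _ => L end.
pose V' (a : A) y := match a with inl n => V n y | inr _ => True end.
apply: (@seg_sum A F V' U (f 0) (inr tt)).
- by case=> [[|n]|b] // H; [case: (H (inl 0))|case: (H (inl 0))].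
- by case=> //= n; apply: seg_start (fS n).
- case=> [n|b] [n'|b'] [ab no] //=; last by case: (no (inl n.+1)) => /=; split.
  suff -> : n' = n.+1 by apply: fS.
  apply: (@nat_succ n n'); split=> // k hk; exact: (no (inl k)).
- case=> [n|b] la.
    case: (@nat_nlim n); split; case: la => -[[k|//] kn] ns; first by exists k.
    move=> y [yn no]; apply: (ns (inl y)); split=> // -[x|x] [] //= h1 h2.
    exact: (no x).
  split=> // i n; move: (L3 i n) => /=; case: (ctape L i n) => H; split=> // _.
    move=> [N|//] _; have [k Nk hk] := H N; exists (inl k); split=> //.
    by case: (ltngtP N k) Nk => // [?|->] _; [right|left].
  have [N HN] := H; exists (inl N) => // -[k|//] y Nk _; apply: HN.
  by case: Nk => [[->]|/ltnW].
- by exists (inl 0).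
- by case=> //= n y _; apply: VU.
Qed.

Lemma halting_runP c d : halting_run c d <-> cstate d = mhalt M /\ reach running c d.
Proof.
split.
  move=> [I [lt [r [z [top [wf [tr [tot [zl [topl [rz [rS [rL [nh [h <-]]]]]]]]]]]]]]].
  split=> //; exists (Wo wf tr tot), r, top; split=> //.
  split=> [i no|i j|j [[i ij] ns]].
  - by have [->//|/no] := zl i.
  - exact: rS.
  - have jz : j <> z.
      move=> e; rewrite e in ij; have [ei|zi] := zl i.
        by rewrite ei in ij; apply: (@wlt_irr (Wo wf tr tot) z).
      exact: (@wlt_asym (Wo wf tr tot) _ _ ij).
    by have [h1 [h2 h3]] := rL j jz ns; split.
case=> hd [W [r [t [R rt H]]]].
(* A halting run needs a greatest index, so the run is cut right after [t]. *)
have hi : winitial (fun x : wo_sub (fun i : W => wle i t) => proj1_sig x : W).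
  by apply: sub_initial => i j ij jt; right; apply: wlt_le_trans jt.
have [z [zt zl]] := wleast (ex_intro (fun i => wle i t) t (or_introl erefl)).
have R' := run_initial hi R.
have eqS (x y : wo_sub (fun i : W => wle i t)) : proj1_sig x = proj1_sig y -> x = y.
  by case: x y => [x px] [y py] /= e; subst y; congr exist; apply: proof_irrelevance.
exists (wo_sub (fun i : W => wle i t)), wlt, (fun x => r (proj1_sig x)),
  (exist _ z zt), (exist _ t (or_introl erefl)) => /=.
have zmin (i : wo_sub (fun i : W => wle i t)) : i = exist _ z zt \/ wlt (exist _ z zt : wo_sub (fun i : W => wle i t)) i.
  by case: (zl _ (proj2_sig i)) => h; [left; apply: eqS|right].
split; first exact: (@wlt_wf (wo_sub _)).
split; first exact: (@wlt_trans (wo_sub _)).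
split; first exact: (@wlt_total (wo_sub _)).
split; first exact: zmin.
split; first by move=> [i [e|it]]; [left; apply: eqS|right].
split.
  apply: (@run0 _ _ _ _ _ R' (exist _ z zt)) => j jz; apply: (wle_nlt (zl _ (proj2_sig j))); exact: jz.
split; first by move=> i j /(runS R').
split.
  move=> j jz ns; have /(runL R')[h1 h2 h3] //: @wlim (wo_sub (fun i : W => wle i t)) j.
  by split=> //; case: (zmin j) => // h; exists (exist _ z zt).
split; first by move=> [i it] h; apply: H.
by rewrite rt.
Qed.

Lemma run_running (W : wo) (r : W -> config M) c :
  is_run r c -> ~ (exists d, halting_run c d) -> forall i, running (r i).
Proof.
move=> R no i hi; have [j [hj jl]] := wleast (ex_intro (fun i => cstate (r i) = mhalt M) i hi).
apply: no; exists (r j); apply/halting_runP; split=> //; exists W, r, j; split=> // k kj hk.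
exact: (wle_nlt (jl k hk)).
Qed.

(** If [d] never halted, the segment followed by a run from [d] over the well-order [H] of the
    halting run would be a run from [c] that never halts, yet is long enough to meet the halting
    configuration. *)
Lemma halts_prefix c d : seg running c d ->
  (exists e, halting_run c e) -> exists e, halting_run d e.
Proof.
move=> cd [e /halting_runP[he [H [s [t [S st _]]]]]]; apply: NNPP => no.
have [r2 R2] := run_exists H d; have nh := run_running R2 no.
pose A := wo_sum wo_unit H.
pose F (a : A) := match a with inl _ => c | inr x => r2 x end.
pose V (a : A) := match a with inl _ => running | inr x => fun y => y = r2 x end.
have [] := @run_sum _ M A F V c.
- by case=> // x h; case: (h (inl tt)).
- by case=> //= _; apply: seg_start cd.
- case=> [a|a] [b|b] [ab ns] //.
    rewrite /F /= (run0 R2 (i := b)) // => j jb; exact: (ns (inr j)).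
  rewrite /F (runS R2 (i := a) (j := b)); first exact: seg_step.
  split=> // k; exact: (ns (inr k)).
- case=> [a|x] [[y yx] ns]; first by case: y yx ns.
  have lx : wlim x.
    have [nox|[[k [kx nk]]|//]] := wcases x.
      by case: (ns (inl tt)); split=> // -[[]|k] [] //= _ /nox.
    by case: (ns (inr k)); split=> // -[[]|l] [] //= h1 h2; apply: (nk l).
  have [h1 h2 h3] := runL R2 lx; split=> // i n; split.
    move=> /h3 hh [[]|k] kx.
      have [[k kx'] _] := lx; have [l [kl [lx' hl]]] := hh k kx'.
      by exists (inr l); split=> //; right.
    have [l [kl [lx' hl]]] := hh k kx; exists (inr l); split=> //.
    by case: kl => [->|]; [left|right].
  move=> /= E; apply: NNPP => hno.
  have : ctape (r2 x) i n = true; last by rewrite E.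
  apply/h3 => k kx; apply: NNPP => hno'; apply: hno; exists (inr k) => // -[[]|b] z.
    by case.
  move=> kb bx ->; apply/negP => hb; apply: hno'.
  by exists b; split=> //; case: kb => [[->]|]; [left|right].
move=> J [r [g [R gm rg HV]]].
have gm' : wmono (fun x : H => g (inr x)) by move=> x y xy; apply: gm.
have [j ej] := run_compare gm' S R t.
have [[[]|a] [_]] := HV j; rewrite /V -ej st => //.
by move=> ee; case: (nh a); rewrite -ee.
Qed.

End Segments.
Arguments running {m M} c.

(** * Simulating each step of a machine by [K] steps of another *)

Section Simulation.
Variables (m m' : nat) (M : machine m) (P : machine m').
(* Each cell of P either is constant or copies a cell of M. *)
Variable s : 'I_m' -> nat -> bool + 'I_m * nat.
(* The boolean tells whether the configuration arises at a limit stage, where the state of P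
   is forced. *)
Variable est : bool -> mstate M -> nat -> mstate P.
Variable ehd : nat -> nat.
Variable K : nat.

Definition enc_tape (T : 'I_m -> nat -> bool) (i : 'I_m') (n : nat) : bool :=
  match s i n with inl v => v | inr (i', n') => T i' n' end.
Definition enc (b : bool) (x : config M) : config P :=
  Config (est b (cstate x) (chead x)) (ehd (chead x)) (enc_tape (ctape x)).
Definition at_limit (x : config M) := cstate x = mlimit M /\ chead x = 0.

Hypothesis K_gt0 : 0 < K.
Hypothesis est_lim : est true (mlimit M) 0 = mlimit P.
Hypothesis ehd0 : ehd 0 = 0.
Hypothesis simE : forall (b : bool) x, (b -> at_limit x) -> running x ->
  iter K (@step m' P) (enc b x) = enc false (step x).
Hypothesis simV : forall (b : bool) x k, (b -> at_limit x) -> running x -> k < K ->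
  running (iter k (@step m' P) (enc b x)) /\
  forall i n, ctape (iter k (@step m' P) (enc b x)) i n = true ->
    ctape (enc b x) i n = true \/ ctape (enc false (step x)) i n = true.

(** The encoded configurations are the checkpoints for [run_sum]. By [simV] a cell is 1 in between
    only if it is 1 at one of the two neighbouring checkpoints; a cell that is 0 at all late
    checkpoints thus stays 0, and the limsups of the two machines correspond. *)
Lemma sim_run (A : wo) (c : A -> config M) x0 :
  is_run c x0 -> (forall a b, wlt a b -> running (c a)) ->
  exists (J : wo) (r : J -> config P) (g : A -> J),
  [/\ is_run r (enc false x0), wmono g,
      forall a, exists2 b : bool, b -> at_limit (c a) & r (g a) = enc b (c a)
    & forall j, exists a, wle (g a) j /\ (running (c a) -> running (r j))].
Proof.
move=> R nh.
pose lm (a : A) := if excluded_middle_informative (wlim a) then true else false.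
have lmP a : lm a -> at_limit (c a).
  by rewrite /lm; case: (excluded_middle_informative _) => // w _; have [] := runL R w.
have lm0 a : ~ wlim a -> lm a = false by rewrite /lm; case: (excluded_middle_informative _).
pose f a := enc (lm a) (c a).
pose V a y := exists2 k, k < K & y = iter k (@step m' P) (f a).
have fS a b : wsucc a b -> f b = enc false (step (c a)).
  move=> ab; rewrite /f lm0 ?(runS R ab) //; by case=> _ /(_ a).
have [] := @run_sum _ P A f V (enc false x0).
- move=> a no; rewrite /f lm0 ?(run0 R no) //; by case=> -[b /no].
- by move=> a; exists 0.
- move=> a b ab; rewrite (fS _ _ ab) -(simE (@lmP a)); last by case: ab => /nh.
  by apply: seg_iter => // j jK; exists j.
- move=> a la; have [h1 h2 h3] := runL R la.
  have lma : lm a by rewrite /lm; case: (excluded_middle_informative _).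
  split; [by rewrite /f lma /= h1 h2|by rewrite /f /= h2|] => i n.
  have tE b : ctape (f b) i n =
      match s i n with inl v => v | inr (i', n') => ctape (c b) i' n' end by [].
  split.
    rewrite tE => E k ka; case sE: (s i n) E => [v|[i' n']].
      by exists k; rewrite tE sE; split=> //; left.
    by move=> /h3/(_ k ka)[l [kl [la' hl]]]; exists l; rewrite tE sE.
  rewrite tE => E.
  suff [k ka H] : exists2 k, wlt k a & forall l, wle k l -> wlt l a -> ctape (f l) i n = false.
    exists k => // b' y kb' b'a [t tK ->].
    have [b2 [bb2 b2a]] := wlim_succ la b'a.
    have [_ /(_ i n)] := simV (@lmP b') (nh _ _ b'a) tK.
    rewrite -(fS _ _ bb2) (H b') // (H b2) //; last first.
      by apply: wle_trans kb' _; right; case: bb2.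
    by move=> HH; apply/negP => /HH[].
  case sE: (s i n) E => [v|[i' n']] E.
    by case: (la) => -[k ka] _; exists k => // l _ _; rewrite tE sE.
  apply: NNPP => hno; suff : ctape (c a) i' n' = true by rewrite E.
  apply/h3 => k ka; apply: NNPP => hno'; apply: hno; exists k => // l kl la'.
  rewrite tE sE; apply/negP => hl; apply: hno'; by exists l.
move=> J [r [g [RJ gm rg HV]]]; exists J, r, g; split=> //.
- by move=> a; exists (lm a); [exact: lmP|exact: rg].
- move=> j; have [a [h1 [k kK ->]]] := HV j; exists a; split=> // na.
  by case: (simV (@lmP a) na kK).
Qed.

Lemma sim_halts x0 xf : halting_run x0 xf ->
  exists2 b : bool, b -> at_limit xf & reach running (enc false x0) (enc b xf).
Proof.
move=> /halting_runP[hf [W [r [t [R rt H]]]]].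
(* [sim_run] wants a running configuration at every index that is not the last, hence the cut at the
   halting time. *)
pose W' := wo_sub (fun i : W => wle i t).
have hi : winitial (fun x : W' => proj1_sig x : W).
  by apply: sub_initial => i j ij jt; right; apply: wlt_le_trans jt.
have [|J [s' [g [RJ gm rg HJ]]]] := sim_run (run_initial hi R).
  move=> [a pa] [b pb] ab; apply: H; exact: (wlt_le_trans (ab : wlt a b) pb).
have [b bl e] := rg (exist _ t (or_introl erefl)); rewrite /= rt in bl e.
exists b => //; exists J, s', (g (exist _ t (or_introl erefl))); split=> // j jt.
have [a [h1 h2]] := HJ j; apply: h2.
apply: H; exact: (wmono_inv gm (wle_lt_trans h1 jt)) .
Qed.

(** If [M] did not halt from [x0], simulating its run over [H] would give a run of [P] that never
    halts and is at least as long as the halting one. *)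
Lemma sim_halts_inv x0 : (exists e, halting_run (enc false x0) e) -> exists e, halting_run x0 e.
Proof.
move=> [e /halting_runP[he [H [s' [t [S st _]]]]]]; apply: NNPP => no.
have [r R] := run_exists H x0; have nh := run_running R no.
have [//|J [r' [g [RJ gm rg HJ]]]] := sim_run R.
have [j ej] := run_compare gm S RJ t.
by have [a [_ /(_ (nh a))]] := HJ j; rewrite -ej st.
Qed.

End Simulation.

(** * From the pad machine to three tapes *)

Section ThreeTapes.
Variable M : machine 1.

Inductive state3 := Copy | Lim3 | Halt3 | Run3 of mstate M & bool.

Definition state3_enc s : option (option (option (mstate M * bool))) :=
  match s with
  | Copy => None | Lim3 => Some None | Halt3 => Some (Some None)
  | Run3 q p => Some (Some (Some (q, p))) end.
Definition state3_dec s := match s with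
  | None => Copy | Some None => Lim3 | Some (Some None) => Halt3
  | Some (Some (Some (q, p))) => Run3 q p end.
Lemma state3_encK : cancel state3_enc state3_dec.
Proof. by case. Qed.
HB.instance Definition _ := Finite.copy state3 (can_type state3_encK).

Definition col3 (a b c : bool) (i : 'I_3) := match val i with 0 => a | 1 => b | _ => c end.
Definition t0 : 'I_3 := @Ordinal 3 0 isT.
Definition t1 : 'I_3 := @Ordinal 3 1 isT.
Definition t2 : 'I_3 := @Ordinal 3 2 isT.

(* Columns are (marker, pad, cell): the marker singles out column 0, whose second track holds
   the pad, and cell n.+1 of M lives on the third track of column n.  The boolean of Run3
   says that the head of M is on the pad. *)
Definition run3 q (pd k p x : bool) : state3 * ('I_3 -> bool) * bool :=
  if q == mhalt M then (Halt3, col3 k p x, false) else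
  let: (q', w, mv) := mdelta q (fun=> if pd then p else x) in
  if pd then (Run3 q' (~~ mv), col3 k (w ord0) x, false)
  else (Run3 q' (~~ mv && k), col3 k p (w ord0), mv).

(** Copying clears the first track, so the limit that ends it finds no marker in column 0 and sets
    it. Limits that find the marker are limits of [M]. *)
Definition delta3 (q : state3) (r : 'I_3 -> bool) : state3 * ('I_3 -> bool) * bool :=
  let k := r t0 in let p := r t1 in let x := r t2 in
  match q with
  | Copy => (Copy, col3 false false k, true)
  | Lim3 => if k then run3 (mlimit M) true k p x
            else (Run3 (mstart M) true, col3 true p x, false)
  | Halt3 => (Halt3, col3 k p x, false)
  | Run3 q pd => run3 q pd k p x
  end.

Definition machine3 : machine 3 := Machine Copy Halt3 Lim3 delta3.

Definition src3 (i : 'I_3) (n : nat) : bool + 'I_1 * nat :=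
  match val i with
  | 0 => inl (n == 0)
  | 1 => if n == 0 then inr (ord0, 0) else inl false
  | _ => inr (ord0, n.+1)
  end.
Definition est3 (b : bool) q h : mstate machine3 := if b then Lim3 else Run3 q (h == 0).
Notation enc3 := (@enc 1 3 M machine3 src3 est3 predn).

Lemma forall_I3 (P : 'I_3 -> Prop) : P t0 -> P t1 -> P t2 -> forall i, P i.
Proof.
move=> h0 h1 h2 [[|[|[|//]]] hi]; [move: h0|move: h1|move: h2];
by congr (P _); apply: val_inj.
Qed.

(** The marker makes [Lim3] act like [Run3 (mlimit M) true], so the forced limit state is forgotten
    after one step. *)
Lemma enc3_limit (b : bool) x : (b -> at_limit x) -> step (enc3 b x) = step (enc3 false x).
Proof.
case: b x => // -[q h T] /(_ isT) [/= -> ->].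
by rewrite /step /= /delta3 /= /enc_tape /=.
Qed.

Lemma sim3 (b : bool) x : (b -> at_limit x) -> running x -> step (enc3 b x) = enc3 false (step x).
Proof.
move=> /enc3_limit ->; case: x => q h T; rewrite /running /= => /eqP/negbTE nh.
rewrite /step /= /run3 nh.
have E n : (fun i : 'I_1 => T i n) = (fun=> T ord0 n).
  by apply: functional_extensionality => i; rewrite (ord1 i).
case: h => [|h]; rewrite E /enc_tape /=.
  case: (mdelta q _) => -[q' w] mv /=.
  apply: config_eq => /=; [by case: mv|by case: mv|].
  apply: forall_I3 => n; rewrite /enc_tape /col3 /src3 /=; by case: n.
case: (mdelta q _) => -[q' w] mv /=.
apply: config_eq => /=; [by case: mv; case: h|by case: mv|].
apply: forall_I3 => n; rewrite /enc_tape /col3 /src3 /= ?eqSS.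
- by case: (n =P h) => [->|].
- by case: (n =P h) => [->|]; [case: h|case: n].
- by [].
Qed.

Lemma copy3 a : seg running (ittm3_start machine3 a) (enc3 false (pad_start 1 M a)).
Proof.
(* After [n] steps the columns below [n] have had their bit moved from the input track to the output
   track. *)
pose T n i p := col3 ((n <= p) && a p) false ((p < n) && a p) i.
pose f n : config machine3 := Config (Copy : mstate machine3) n (T n).
have fS n : step (f n) = f n.+1.
  apply: config_eq => //=; apply: forall_I3 => p; rewrite /T /col3 /=.
  - by rewrite [n < p]ltn_neqAle eq_sym; case: (n =P p).
  - by case: eqP.
  - by rewrite ltnS [p <= n]leq_eqVlt; case: (p =P n) => [->|] //=; rewrite leqnn.
have -> : ittm3_start machine3 a = f 0.
  by apply: config_eq => //=; apply: forall_I3.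
pose L : config machine3 := Config (Lim3 : mstate machine3) 0 (fun i p => col3 false false (a p) i).
have -> : enc3 false (pad_start 1 M a) = step L.
  apply: config_eq => //=; apply: forall_I3 => p; rewrite /enc_tape /src3 /col3 /= ?subn1;
    by case: p.
apply: (@seg_trans _ _ _ _ L); last exact: seg_step.
apply: (@seg_omega _ _ f (fun n y => y = f n)) => //.
- by move=> n; rewrite -fS; apply: seg_step.
- by move=> n y ->.
- apply: forall_I3 => p; rewrite /= /col3 /=.
  + by exists p.+1 => n y np ->; rewrite /= /T /col3 /= leqNgt np.
  + by exists 0 => n y _ ->.
  + case ap: (a p).
      by move=> N; exists (maxn N p.+1); rewrite ?leq_maxl //= /T /col3 /= ap leq_max ltnSn orbT.
    by exists 0 => n y _ ->; rewrite /= /T /col3 /= ap andbF.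
Qed.

End ThreeTapes.

Lemma pad_ittm f : pad_computable 1 f -> ittm_computable f.
Proof.
move=> [M HM]; exists (machine3 M) => a; move: (HM a).
have simV (b : bool) x k : (b -> at_limit x) -> running x -> k < 1 ->
    running (iter k (@step _ (machine3 M)) (enc (@src3) (@est3 M) predn b x)) /\
  forall i n, ctape (iter k (@step _ (machine3 M)) (enc (@src3) (@est3 M) predn b x)) i n = true ->
    ctape (enc (@src3) (@est3 M) predn b x) i n = true \/ ctape (enc (@src3) (@est3 M) predn false (step x)) i n = true.
  by case: k => // _ _ _; split; [case: b|left].
case: (f a) => [b [cf [hr cb]]|no].
  have [l lP re] := sim_halts (erefl : 0 < 1) erefl erefl (@sim3 M) simV hr.
  have hcf : cstate cf = mhalt M by case/halting_runP: hr.
  (* One more step leads to [Halt3]. The flag [l] covers a machine [M] that halts at a limit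
     stage. *)
  exists (step (enc (@src3) (@est3 M) predn l cf)); split.
    apply/halting_runP; split.
      by rewrite enc3_limit // /step /= /run3 hcf eqxx.
    apply/reachE; right; apply: seg_trans (copy3 M a) _.
    have st : seg running (enc (@src3) (@est3 M) predn l cf) (step (enc (@src3) (@est3 M) predn l cf)).
      by apply: seg_step; case: (l).
    case/reachE: re => [-> |re]; first exact: st.
    exact: seg_trans re st.
  move=> n; rewrite enc3_limit // /step /= /run3 hcf eqxx /=.
  by rewrite -cb addn1 /enc_tape /=; case: eqP => [->|].
move=> H; apply: no.
apply: (sim_halts_inv (erefl : 0 < 1) erefl erefl (@sim3 M) simV).
exact: halts_prefix (copy3 M a) H.
Qed.

(** * Several tracks on one tape *)

Section Blocks.
Variables (w' : nat).
Notation w := w'.+1.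
Variable N : machine w.

Inductive bstate :=
| Rd of mstate N & 'I_w & {ffun 'I_w -> bool}
| Wr of mstate N & bool & 'I_w & {ffun 'I_w -> bool}
| Mv of mstate N & bool & 'I_w.

Definition bstate_enc s : mstate N * 'I_w * {ffun 'I_w -> bool} +
    (mstate N * bool * 'I_w * {ffun 'I_w -> bool} + mstate N * bool * 'I_w) :=
  match s with
  | Rd q i a => inl (q, i, a) | Wr q b i a => inr (inl (q, b, i, a))
  | Mv q b i => inr (inr (q, b, i)) end.
Definition bstate_dec s := match s with
  | inl (q, i, a) => Rd q i a | inr (inl (q, b, i, a)) => Wr q b i a
  | inr (inr (q, b, i)) => Mv q b i end.
Lemma bstate_encK : cancel bstate_enc bstate_dec.
Proof. by case. Qed.
HB.instance Definition _ := Finite.copy bstate (can_type bstate_encK).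

(* Column h of N is the block of cells h*w, ..., h*w+w'.  A step of N reads the block from left to
   right, rewrites it from right to left, then moves w cells; at block 0 the truncation of left
   moves is the right behaviour. *)
Definition bstart q := Rd q ord0 [ffun=> false].
Definition bmove q mv k := if k is k'.+1 then Mv q mv (inord k) else bstart q.
Definition bwrite q (mv : bool) (i : 'I_w) (o : {ffun 'I_w -> bool}) : bstate * bool * bool :=
  if val i is k.+1 then (Wr q mv (inord k) o, o i, false) else (bmove q mv w', o i, mv).
Definition bdelta (s : bstate) (r : bool) : bstate * bool * bool :=
  match s with
  | Rd q i a =>
      let a' := [ffun j => if j == i then r else a j] in
      if val i == w' then
        let: (q', o, mv) := mdelta q (fun j => a' j) in bwrite q' mv i [ffun j => o j]
      else (Rd q (inord i.+1) a', r, true)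
  | Wr q mv i o => bwrite q mv i o
  | Mv q mv i => (bmove q mv i.-1, r, mv)
  end.
Definition block_machine : machine 1 :=
  @Machine 1 bstate (bstart (mstart N)) (bstart (mhalt N)) (bstart (mlimit N))
    (fun s r => let: (s', b, mv) := bdelta s (r ord0) in (s', fun=> b, mv)).

Definition bsrc (i : 'I_1) (p : nat) : bool + 'I_w * nat := inr (inord (p %% w), p %/ w).
Definition best (b : bool) q (h : nat) : mstate block_machine := bstart q.
Definition bhd h := h * w.
Notation encb := (@enc w 1 N block_machine bsrc best bhd).

Lemma bstepE s p t s' b mv : bdelta s (t p) = (s', b, mv) ->
  step (@Config _ block_machine s p (fun=> t)) =
  @Config _ block_machine s' (if mv then p.+1 else p.-1) (fun _ n => if n == p then b else t n).
Proof. by rewrite /step /= => ->. Qed.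

Lemma bhd_move (mv : bool) h :
  (if mv then h * w + w else h * w - w) = bhd (if mv then h.+1 else h.-1).
Proof.
rewrite /bhd; case: mv; first by rewrite mulSn addnC.
by case: h => [|h]; rewrite ?mul0n // [in LHS]mulSn addKn.
Qed.

(** * One simulated step, cell by cell *)

Section MacroStep.
Variables (q : mstate N) (h : nat) (T : 'I_w -> nat -> bool).
Variables (q' : mstate N) (o : 'I_w -> bool) (mv : bool).
Hypothesis dE : mdelta q (fun i => T i h) = (q', o, mv).

Let ET p := T (inord (p %% w)) (p %/ w).
Let WT j p := if (p %/ w == h) && (j <= p %% w) then o (inord (p %% w)) else ET p.
Let bits := [ffun j => o j].
Let rd k : config block_machine :=
  @Config _ block_machine (Rd q (inord k) [ffun j : 'I_w => (j < k) && T j h]) (h * w + k) (fun=> ET).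
Let wr k : config block_machine :=
  @Config _ block_machine (Wr q' mv (inord k) bits) (h * w + k) (fun=> WT k.+1).
Let mvc k : config block_machine :=
  @Config _ block_machine (bmove q' mv k) (if mv then h * w + (w - k) else h * w - (w - k)) (fun=> WT 0).

Let divE k : k < w -> (h * w + k) %/ w = h.
Proof. by move=> kw; rewrite divnMDl // divn_small ?addn0. Qed.
Let modE k : k < w -> (h * w + k) %% w = k.
Proof. by move=> kw; rewrite modnMDl modn_small. Qed.

Let eq_hk p k : k < w -> (p == h * w + k) = (p %/ w == h) && (p %% w == k).
Proof.
move=> kw; apply/eqP/andP => [->|[/eqP <- /eqP <-]]; last exact: divn_eq.
by rewrite divE // modE // !eqxx.
Qed.

Let rd_acc k : k < w ->
  [ffun j : 'I_w => if j == inord k then ET (h * w + k) else [ffun j : 'I_w => (j < k) && T j h] j]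
  = [ffun j : 'I_w => (j < k.+1) && T j h].
Proof.
move=> kw; apply/ffunP => j; rewrite !ffunE /ET divE // modE // ltnS.
case: (j =P inord k) => [->|ne]; first by rewrite inordK // leqnn.
rewrite [X in _ = X && _]leq_eqVlt; by case: (nat_of_ord j =P k) => // e; case: ne; apply: ord_inj; rewrite inordK.
Qed.

Let step_rd k : k < w' -> step (rd k) = rd k.+1.
Proof.
move=> kw; rewrite (@bstepE _ _ _ (Rd q (inord k.+1) [ffun j : 'I_w => (j < k.+1) && T j h]) (ET (h * w + k)) true).
  by rewrite /rd addnS; apply: config_eq => //= _ n; case: eqP => [->|].
by rewrite /= inordK ?(ltn_eqF kw) ?rd_acc //; lia.
Qed.

Let WT_upd k p : k < w -> (if p == h * w + k then o (inord k) else WT k.+1 p) = WT k p.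
Proof.
move=> kw; rewrite eq_hk // /WT.
case: (p %/ w == h) => //=; rewrite [k <= _]leq_eqVlt eq_sym.
by case: eqP => [<-|].
Qed.

Let step_wr k : k < w' -> step (wr k.+1) = wr k.
Proof.
move=> kw; rewrite (@bstepE _ _ _ (Wr q' mv (inord k) bits) (o (inord k.+1)) false).
  rewrite /wr addnS /=; apply: config_eq => //= _ n.
  by rewrite -addnS WT_upd //; lia.
by rewrite /= /bwrite /= inordK ?ffunE //; lia.
Qed.

Let step_wr0 : step (wr 0) = mvc w'.
Proof.
rewrite (@bstepE _ _ _ (bmove q' mv w') (o (inord 0)) mv).
  rewrite /mvc subSnn addn0 addn1 subn1; apply: config_eq => //= _ n.
  by rewrite -[h * w]addn0 WT_upd.
by rewrite /= /bwrite /= inordK //= ffunE.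
Qed.

(** Reading the last cell completes the column, so that same step already writes the cell, just as
    the first writing state would. *)
Let step_rdw : step (rd w') = step (wr w').
Proof.
pose X := bwrite q' mv (inord w') bits.
have EX : X = (X.1.1, X.1.2, X.2) by case: X => -[].
rewrite (@bstepE _ _ _ X.1.1 X.1.2 X.2) ?(@bstepE (Wr q' mv (inord w') bits) _ _ X.1.1 X.1.2 X.2) //.
  rewrite /=; congr Config.
  apply: functional_extensionality => _; apply: functional_extensionality => n.
  case: eqP => // _; rewrite /WT; case: andP => // -[_]; rewrite leqNgt.
  by rewrite ltn_pmod.
rewrite /= inordK // eqxx rd_acc // -EX.
have -> : (fun j => [ffun j : 'I_w => (j < w) && T j h] j) = (fun i => T i h).
  by apply: functional_extensionality => j; rewrite ffunE ltn_ord.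
by rewrite dE.
Qed.

Let step_mv k : k < w' -> step (mvc k.+1) = mvc k.
Proof.
move=> kw; rewrite (@bstepE _ _ _ (bmove q' mv k) (WT 0 (if mv then h * w + (w - k.+1) else h * w - (w - k.+1))) mv).
  rewrite /mvc; apply: config_eq => //=; first by case: mv; lia.
  by move=> _ n; case: eqP => [->|].
by rewrite /= inordK //; lia.
Qed.

(** [w] reading steps, the last of which also writes; [w'] writing steps, the last of which also
    moves (for [w' = 0] the single reading step does all three); then [w'] moves. This makes
    [3 * w' + 1] steps. *)
Let path k := if k <= w' then rd k else if k <= w' + w' then wr (w' + w' - k) else mvc ((w' + w' + w) - k).

Let step_path k : k < w' + w' + w -> step (path k) = path k.+1.
Proof.
move=> kK; rewrite /path; case: (ltngtP k w') => [kw|kw|->].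
- by rewrite step_rd // (ltnW kw).
- case: (ltngtP k (w' + w')) => [k2|k2|->].
  + have -> : w' + w' - k = (w' + w' - k.+1).+1 by lia.
    by rewrite step_wr //; lia.
  + have -> : w' + w' + w - k = (w' + w' + w - k.+1).+1 by lia.
    by rewrite step_mv //; lia.
  + rewrite subnn step_wr0.
    by congr mvc; lia.
- rewrite step_rdw; case: ifP => h1.
    have -> : wr w' = wr (w' + w' - w'.+1).+1 by congr wr; lia.
    by rewrite step_wr //; lia.
  have w0 : w' = 0 by lia.
  have -> : w' + w' + w - w'.+1 = w' by lia.
  by rewrite -step_wr0; congr (step (wr _)).
Qed.

Let x := @Config _ N q h T.
Let path0 : path 0 = encb false x.
Proof.
rewrite /path /rd /encb addn0 /=; congr Config.
rewrite /best /bstart; congr Rd; by apply: val_inj; rewrite /= inordK.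
Qed.

Let pathK : path (w' + w' + w) = encb false (step x).
Proof.
rewrite /path /step /= dE.
have -> : (w' + w' + w <= w') = false by lia.
have -> : (w' + w' + w <= w' + w') = false by lia.
rewrite subnn; apply: config_eq => //=.
  by rewrite subn0; apply: bhd_move.
by move=> i n; rewrite /enc_tape /= /WT /ET andbT.
Qed.

Let iter_path k : k <= w' + w' + w -> iter k (@step _ block_machine) (encb false x) = path k.
Proof.
elim: k => [_|k IH kK]; first by rewrite path0.
by rewrite iterS IH ?step_path //; lia.
Qed.

Lemma block_simE : iter (w' + w' + w) (@step _ block_machine) (encb false x) = encb false (step x).
Proof. by rewrite iter_path. Qed.

(** At every moment each cell holds its old value or its final one. *)
Lemma block_simV k : q <> mhalt N -> k < w' + w' + w ->
  running (iter k (@step _ block_machine) (encb false x)) /\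
  forall i n, ctape (iter k (@step _ block_machine) (encb false x)) i n = true ->
    ctape (encb false x) i n = true \/ ctape (encb false (step x)) i n = true.
Proof.
move=> nh kK; rewrite iter_path 1?ltnW // -pathK.
have -> : path (w' + w' + w) = mvc 0.
  have e1 : (w' + w' + w <= w') = false by lia.
  have e2 : (w' + w' + w <= w' + w') = false by lia.
  by rewrite /path e1 e2 subnn.
have WTE j n : WT j n = true -> ET n = true \/ WT 0 n = true.
  by rewrite /WT; case: (_ == h) => //=; [case: ifP => _; [right|left]|left].
rewrite /path; case: leqP => h1; first by split; [case|left].
case: leqP => h2; first by split=> // i n /WTE.
split=> [|i n]; last by right.
by have -> : w' + w' + w - k = (w' + w' + w - k.+1).+1 by lia.
Qed.
End MacroStep.

Notation K := (w' + w' + w).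

Lemma block_sim (b : bool) x : (b -> at_limit x) -> running x ->
  iter K (@step _ block_machine) (encb b x) = encb false (step x).
Proof.
case: x => q h T _ _; case dE: (mdelta q (fun i => T i h)) => [[q' o] mv].
exact: block_simE dE.
Qed.

Lemma block_between (b : bool) x k : (b -> at_limit x) -> running x -> k < K ->
  running (iter k (@step _ block_machine) (encb b x)) /\
  forall i n, ctape (iter k (@step _ block_machine) (encb b x)) i n = true ->
    ctape (encb b x) i n = true \/ ctape (encb false (step x)) i n = true.
Proof.
case: x => q h T _; case dE: (mdelta q (fun i => T i h)) => [[q' o] mv] nh kK.
exact: (block_simV dE nh kK).
Qed.

Let K_gt0 : 0 < K. Proof. by rewrite addnS. Qed.

Lemma block_halts x0 xf : halting_run x0 xf -> halting_run (encb false x0) (encb false xf).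
Proof.
move=> hr; have hf : cstate xf = mhalt N by case/halting_runP: hr.
have [b _ re] := sim_halts K_gt0 erefl erefl block_sim block_between hr.
by apply/halting_runP; split; [rewrite /= /best hf|exact: re].
Qed.

Lemma block_halts_inv x0 : (exists e, halting_run (encb false x0) e) -> exists e, halting_run x0 e.
Proof. exact: (sim_halts_inv K_gt0 erefl erefl block_sim block_between). Qed.
End Blocks.

(** * From three tapes to five tracks *)

Section FiveTracks.
Variable N : machine 3.

Inductive state5 :=
| Seek | Flash | Lim5 | Halt5 | Front | Forward
| Carry3 of bool & bool & bool
| Carry4 of bool & bool & bool & bool
| Run5 of mstate N
| Gather1 of bool | Gather2 of bool & bool | Gather3 of bool & bool & bool
| Gather4 of bool & bool & bool & bool
| Back of bool & bool & bool & bool & bool.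

Definition state5_enc s : mstate N + 'I_13 * (bool * bool * bool * bool * bool) :=
  let f := false in
  match s with
  | Seek => inr (@Ordinal 13 0 isT, (f, f, f, f, f))
  | Flash => inr (@Ordinal 13 1 isT, (f, f, f, f, f))
  | Lim5 => inr (@Ordinal 13 2 isT, (f, f, f, f, f))
  | Halt5 => inr (@Ordinal 13 3 isT, (f, f, f, f, f))
  | Front => inr (@Ordinal 13 4 isT, (f, f, f, f, f))
  | Forward => inr (@Ordinal 13 5 isT, (f, f, f, f, f))
  | Carry3 a b c => inr (@Ordinal 13 6 isT, (a, b, c, f, f))
  | Carry4 a b c d => inr (@Ordinal 13 7 isT, (a, b, c, d, f))
  | Run5 q => inl q
  | Gather1 a => inr (@Ordinal 13 8 isT, (a, f, f, f, f))
  | Gather2 a b => inr (@Ordinal 13 9 isT, (a, b, f, f, f))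
  | Gather3 a b c => inr (@Ordinal 13 10 isT, (a, b, c, f, f))
  | Gather4 a b c d => inr (@Ordinal 13 11 isT, (a, b, c, d, f))
  | Back a b c d e => inr (@Ordinal 13 12 isT, (a, b, c, d, e))
  end.
Definition state5_dec (s : mstate N + 'I_13 * (bool * bool * bool * bool * bool)) := match s with
  | inl q => Run5 q
  | inr (k, (a, b, c, d, e)) => match nat_of_ord k with
    | 0 => Seek | 1 => Flash | 2 => Lim5 | 3 => Halt5 | 4 => Front | 5 => Forward
    | 6 => Carry3 a b c | 7 => Carry4 a b c d | 8 => Gather1 a | 9 => Gather2 a b
    | 10 => Gather3 a b c | 11 => Gather4 a b c d | _ => Back a b c d e end
  end.
Lemma state5_encK : cancel state5_enc state5_dec.
Proof. by case. Qed.
HB.instance Definition _ := Finite.copy state5 (can_type state5_encK).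

Definition column := (bool * bool * bool * bool * bool)%type.
Definition zero5 : column := (false, false, false, false, false).
Definition front5 : column := (true, false, false, false, false).
Definition col5 (c : column) (i : nat) : bool :=
  let: (m, g, x, y, z) := c in
  match i with 0 => m | 1 => g | 2 => x | 3 => y | _ => z end.
Definition read5 (r : 'I_5 -> bool) : column :=
  (r (@Ordinal 5 0 isT), r (@Ordinal 5 1 isT), r (@Ordinal 5 2 isT),
   r (@Ordinal 5 3 isT), r (@Ordinal 5 4 isT)).

(* A column (m, g, x, y, z) in expanded form has m = 1 and carries the three tapes of N in
   x, y, z; g = 1 marks column 0 once the simulation runs.  Bit m of column 0 is the scratch
   pad: a limit stage with m = 0 there ends the computation. *)
Definition run5 q (c : column) : state5 * column * bool :=
  let: (m, g, x, y, z) := c in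
  if q == mhalt N then
    if g then (Gather2 false z, front5, true) else (Run5 q, c, false)
  else let: (q', o, mv) := mdelta q (col3 x y z) in
    (Run5 q', (m, g, o t0, o t1, o t2), mv).

(** Expanding: [Seek] crosses the expanded columns up to the first with m = 0, keeps one input bit
    there, and the carry states move the rest four cells to the right. Packing: [front5] marks the
    column to fill; the gather states collect output bits and erase their columns, [Back] returns
    over zeros to the marker, and [Forward] crosses zeros to the next unread column. In [Lim5],
    column 0 tells the limits apart: m = 0 for packed output, g = 1 for a limit of [N], z = 1 for
    the end of the expansion, otherwise the end of one pass. *)
Definition delta5 (s : state5) (c : column) : state5 * column * bool :=
  let: (m, g, x, y, z) := c in
  match s with
  | Seek => if m then (Seek, c, true)
            else (Carry3 x y z, (true, false, g, false, false), true)
  | Carry3 b1 b2 b3 => (Carry4 g x y z, (false, b1, b2, b3, m), true)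
  | Carry4 b1 b2 b3 b4 => (Carry4 g x y z, (b1, b2, b3, b4, m), true)
  | Lim5 =>
      if m then
        if g then run5 (mlimit N) c
        else if z then (Run5 (mstart N), (true, true, x, y, false), false)
        else (Flash, (true, false, x, y, true), false)
      else (Halt5, c, false)
  | Flash => (Seek, (m, g, x, y, false), true)
  | Run5 q => run5 q c
  | Gather1 b1 => (Gather2 b1 z, zero5, true)
  | Gather2 b1 b2 => (Gather3 b1 b2 z, zero5, true)
  | Gather3 b1 b2 b3 => (Gather4 b1 b2 b3 z, zero5, true)
  | Gather4 b1 b2 b3 b4 => (Back b1 b2 b3 b4 z, zero5, false)
  | Back b1 b2 b3 b4 b5 => if m then (Front, (b1, b2, b3, b4, b5), true) else (s, c, false)
  | Front => (Forward, front5, true)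
  | Forward => if m then (Gather1 z, zero5, true) else (Forward, c, true)
  | Halt5 => (Halt5, c, false)
  end.

Definition machine5 : machine 5 := @Machine 5 state5 Seek Halt5 Lim5
  (fun s r => let: (s', c, mv) := delta5 s (read5 r) in (s', fun i : 'I_5 => col5 c i, mv)).

Definition conf5 (s : state5) h (C : nat -> column) : config machine5 :=
  @Config 5 machine5 s h (fun i n => col5 (C n) i).

Lemma conf5_eq s h C C' : C =1 C' -> conf5 s h C = conf5 s h C'.
Proof. by move=> e; apply: config_eq => //= i n; rewrite e. Qed.

Lemma step5 s h C s' c (mv : bool) h' C' :
  delta5 s (C h) = (s', c, mv) -> h' = (if mv then h.+1 else h.-1) ->
  (forall n, C' n = if n == h then c else C n) ->
  step (conf5 s h C) = conf5 s' h' C'.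
Proof.
move=> d -> e.
have E : read5 (fun i => col5 (C h) i) = C h by case: (C h) => [[[[]]]].
have D : @mdelta 5 machine5 s (fun i => col5 (C h) i) = (s', (fun i : 'I_5 => col5 c i), mv).
  by rewrite -[LHS]/(let: (s', c, mv) := delta5 s (read5 (fun i => col5 (C h) i)) in
    (s', (fun i : 'I_5 => col5 c i), mv)) E d.
rewrite /step [mdelta _ _]D; apply: config_eq => //= i n.
by rewrite e; case: ifP.
Qed.

Lemma running5 s h C : s != Halt5 -> running (conf5 s h C).
Proof. by move=> /eqP. Qed.

(** The case where every column eventually stops changing, so that the limsup is a plain limit. *)
Lemma limit5 (f : nat -> config machine5) (V : nat -> config machine5 -> Prop) U C :
  (forall n, seg (V n) (f n) (f n.+1)) -> (forall n y, V n y -> U y) ->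
  (forall p, exists N0, forall n y, N0 <= n -> V n y -> forall i, ctape y i p = col5 (C p) i) ->
  seg U (f 0) (conf5 Lim5 0 C).
Proof.
move=> fS VU H; apply: (seg_omega fS VU) => // i p /=.
have [n0 Hn] := H p; case E: (col5 (C p) i).
  move=> n1; exists (maxn n0 n1); first exact: leq_maxr.
  by rewrite (Hn (maxn n0 n1)) ?leq_maxl //; apply: seg_start (fS _).
by exists n0 => n y h1 h2; rewrite (Hn n) // E.
Qed.

(** * Spreading the input, one bit per column *)

Section Expand.
Variable a : real2.

(* After n passes: n expanded columns, a column opening with 0, and the rest of the input. *)
Definition expanded n p : column :=
  if p < n then (true, false, a p, false, false)
  else let k := 5 * p - 4 * n in ((n < p) && a k.-1, a k, a k.+1, a k.+2, a k.+3).

(** Beyond the column being freed, the state carries the last four bits of the old column [t.-1]. *)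
Definition pass_state n t : state5 :=
  if t <= n then Seek else
  if t == n.+1 then Carry3 (a n.+1) (a n.+2) (a n.+3)
  else let k := 5 * t.-1 - 4 * n in Carry4 (a k) (a k.+1) (a k.+2) (a k.+3).
Definition pass n t := conf5 (pass_state n t) t
  (fun p => if p < t then expanded n.+1 p else expanded n p).

Lemma expanded_lt n p : p < n -> expanded n p = (true, false, a p, false, false).
Proof. by rewrite /expanded => ->. Qed.

Lemma pass_step n t : step (pass n t) = pass n t.+1.
Proof.
have C c : c = expanded n.+1 t -> forall p,
    (if p < t.+1 then expanded n.+1 p else expanded n p) =
    if p == t then c else if p < t then expanded n.+1 p else expanded n p.
  by move=> -> p; rewrite ltnS leq_eqVlt; case: eqP => [->|].
apply: (@step5 _ _ _ _ _ true _ _ _ erefl (C _ erefl)); rewrite ltnn /pass_state.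
case: (ltngtP t n) => [tn|nt|->].
- by rewrite !expanded_lt //; lia.
- case: (t =P n.+1) => [e|ne].
    subst t; rewrite /expanded.
    have -> : (n.+1 < n) = false by lia.
    have -> : (n.+2 == n.+1) = false by lia.
    rewrite ltnSn ltnn /=.
    have -> : 5 * n.+1 - 4 * n = n.+4.+1 by lia.
    by have -> : 5 * n.+1 - 4 * n.+1 = n.+1 by lia.
  (* The shift by four cells: the new column [t] opens with the first of the four carried bits, and
     the old first bit of column [t] becomes its last. *)
  have -> : (t.+1 == n.+1) = false by lia.
  rewrite /expanded.
  have -> : (t < n) = false by lia.
  have -> : (t < n.+1) = false by lia.
  have -> : n.+1 < t by lia.
  rewrite nt /=.
  have -> : 5 * t - 4 * n = (5 * t.-1 - 4 * n).+4.+1 by lia.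
  by have -> : 5 * t - 4 * n.+1 = (5 * t.-1 - 4 * n).+1 by lia.
- rewrite eqxx /expanded ltnn ltnSn /=.
  by have -> : 5 * n - 4 * n = n by lia.
Qed.

Lemma pass_running n t : running (pass n t).
Proof. by apply: running5; rewrite /pass_state; do 2?case: ifP. Qed.

(** The starting time varies: the very first pass begins at column 0, the others at column 1 after
    the flash. *)
Lemma pass_seg n t V : (forall t, V (pass n t)) ->
  seg V (pass n t) (conf5 Lim5 0 (expanded n.+1)).
Proof.
move=> HV; have := @limit5 (fun k => pass n (t + k)) (fun k y => y = pass n (t + k)) V (expanded n.+1).
rewrite addn0; apply.
- by move=> k; rewrite addnS -pass_step; apply: seg_step.
- by move=> k y ->.
- move=> p; exists p.+1 => k y pk -> i /=.
  by have -> : p < t + k by lia.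
Qed.

Definition flashed p : column := (true, false, a p, false, p == 0).
Definition flash n := conf5 Flash 0 (fun p => if p == 0 then flashed 0 else expanded n.+1 p).

Lemma limit_flash n : step (conf5 Lim5 0 (expanded n.+1)) = flash n.
Proof. by apply: step5. Qed.

Lemma flash_pass n : step (flash n) = pass n.+1 1.
Proof. by apply: step5 => // -[|p]. Qed.

(** The first pass has no flash and is treated apart. From then on the flashes are the checkpoints:
    the flash bit is 1 at each of them, hence at their limit, and every other cell has its final
    value from some checkpoint on. *)
Lemma expand_seg : seg running (conf5 Seek 0 (expanded 0)) (conf5 Lim5 0 flashed).
Proof.
apply: (@seg_trans _ _ _ _ (flash 0)).
  apply: (@seg_trans _ _ _ _ (conf5 Lim5 0 (expanded 1))).
    have -> : conf5 Seek 0 (expanded 0) = pass 0 0 by apply: conf5_eq.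
    exact: pass_seg (@pass_running 0).
  by rewrite -limit_flash; apply: seg_step.
(* From flash [n] to the next, columns up to [n] change only in the flash bit, so the zeros of the
   limit there are never disturbed. *)
pose V n (y : config machine5) := running y /\
  forall (i : 'I_5) p, p <= n -> col5 (flashed p) i = false -> ctape y i p = false.
have VE n C s h : s != Halt5 -> (forall p, p <= n -> C p = (true, false, a p, false, false) \/ C p = flashed p) ->
    V n (conf5 s h C).
  move=> sH HC; split; first exact: running5.
  move=> i p pn; rewrite /=; case: (HC p pn) => -> //.
  by rewrite /flashed /col5; case: (nat_of_ord i) => [|[|[|[|]]]].
have Vpass n t : V n (pass n.+1 t).
  apply: VE; first by rewrite /pass_state; do 2?case: ifP.
  by move=> p pn; left; case: ifP => _; rewrite expanded_lt //; lia.
apply: (@seg_omega _ _ flash V) => //.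
- move=> n; apply: (@seg_trans _ _ _ _ (pass n.+1 1)).
    rewrite -flash_pass; apply: seg_step; apply: VE => // p pn.
    by case: eqP => [->|_]; [right|left; rewrite expanded_lt].
  rewrite -limit_flash; apply: seg_trans (pass_seg _ (Vpass n)) _.
  apply: seg_step; apply: VE => // p pn; left; rewrite expanded_lt //; lia.
- by move=> n y [].
- move=> i p; case E: (ctape _ _ _).
    move=> n; exists (maxn n p); first exact: leq_maxl.
    rewrite [ctape _ _ _]/(col5 (if p == 0 then _ else _) i).
    case: (p =P 0) E => [-> //|/eqP/negbTE p0 E].
    by move: E; rewrite [ctape _ _ _]/(col5 (flashed p) i) /flashed p0 expanded_lt // ltnS leq_maxr.
  by exists p => n y pn [_]; apply.
Qed.
End Expand.

Definition src5 (i : 'I_5) (n : nat) : bool + 'I_3 * nat :=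
  match val i with
  | 0 => inl true | 1 => inl (n == 0)
  | 2 => inr (t0, n) | 3 => inr (t1, n) | _ => inr (t2, n)
  end.
Definition est5 (b : bool) q (h : nat) : mstate machine5 := if b then Lim5 else Run5 q.
Notation enc5 := (@enc 3 5 N machine5 src5 est5 id).

Lemma enc5E b x : enc5 b x = conf5 (if b then Lim5 else Run5 (cstate x)) (chead x)
  (fun p => (true, p == 0, ctape x t0 p, ctape x t1 p, ctape x t2 p)).
Proof.
apply: config_eq => //= i n; rewrite /enc_tape /src5 /=.
by case: i => [[|[|[|[|[|//]]]]] hi].
Qed.

Lemma start5 a : seg running (conf5 Seek 0 (expanded a 0)) (enc5 false (ittm3_start N a)).
Proof.
have -> : enc5 false (ittm3_start N a) = step (conf5 Lim5 0 (flashed a)).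
  rewrite enc5E; symmetry; apply: step5 => // -[|p] //.
by apply: seg_trans (expand_seg a) _; apply: seg_step.
Qed.

Lemma enc5_limit (b : bool) x : (b -> at_limit x) -> step (enc5 b x) = step (enc5 false x).
Proof.
case: b x => // -[q h T] /(_ isT) [/= -> ->]; rewrite !enc5E /=.
case E: (run5 (mlimit N) (true, 0 == 0, T t0 0, T t1 0, T t2 0)) => [[s c] mv].
by rewrite !(@step5 _ _ _ s c mv _ _ _ erefl (fun=> erefl)).
Qed.

Lemma sim5 (b : bool) x : (b -> at_limit x) -> running x -> step (enc5 b x) = enc5 false (step x).
Proof.
move=> /enc5_limit ->; case: x => q h T; rewrite /running /= => /eqP/negbTE nh.
case E: (mdelta q (fun i => T i h)) => [[q' o] mv].
have -> : step (Config q h T) = Config q' (if mv then h.+1 else h.-1)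
    (fun i n => if n == h then o i else T i n) by rewrite /step /= E.
have ET : col3 (T t0 h) (T t1 h) (T t2 h) = (fun i => T i h).
  by apply: functional_extensionality; apply: forall_I3.
rewrite !enc5E; apply: (@step5 _ _ _ _ (true, h == 0, o t0, o t1, o t2) mv) => //=.
  by rewrite /run5 nh ET E.
by move=> p; case: (p =P h) => [->|].
Qed.

(** * Packing the output *)

Section Compress.
Variables x y b : real2.
Let C0 p : column := (true, p == 0, x p, y p, b p).
Notation packed := (expanded b 0).

Let fixed F (c : config machine5) := running c /\ forall p i, p < F -> ctape c i p = col5 (packed p) i.

Let fixedE F s h C : s != Halt5 -> (forall p, p < F -> C p = packed p) -> fixed F (conf5 s h C).
Proof. by move=> sH HC; split=> [|p i pF]; [exact: running5|rewrite /= HC]. Qed.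

Let walk_forward F C h k : (forall p, p < F -> C p = packed p) ->
  (forall p, h <= p < h + k -> C p = zero5) ->
  reach (fixed F) (conf5 Forward h C) (conf5 Forward (h + k) C).
Proof.
move=> HC; elim: k h => [|k IH] h H; first by rewrite addn0; apply: reach_refl.
apply: reach_step; first exact: fixedE.
have E : C h = zero5 by apply: H; lia.
rewrite (@step5 _ _ _ Forward zero5 true h.+1 C) //; last by move=> n; case: eqP => // ->.
  by rewrite -addSnnS; apply: IH => p hp; apply: H; lia.
by rewrite E.
Qed.

Let walk_back F C h k b1 b2 b3 b4 b5 : (forall p, p < F -> C p = packed p) ->
  (forall p, h < p <= h + k -> C p = zero5) ->
  reach (fixed F) (conf5 (Back b1 b2 b3 b4 b5) (h + k) C) (conf5 (Back b1 b2 b3 b4 b5) h C).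
Proof.
move=> HC; elim: k => [|k IH] H; first by rewrite addn0; apply: reach_refl.
apply: reach_step; first exact: fixedE.
have E : C (h + k.+1) = zero5 by apply: H; lia.
rewrite (@step5 _ _ _ (Back b1 b2 b3 b4 b5) zero5 false (h + k) C) //.
- by apply: IH => p hp; apply: H; lia.
- by rewrite E.
- by rewrite addnS.
- by move=> n; case: eqP => // ->.
Qed.

(** It starts with two bits in hand because the first round has the pad bit 0 and [b 0] at that
    point, and later rounds get there through [Gather1]. *)
Let gather F C k b1 b2 C' : (forall p, p < F -> C p = packed p) -> C F = front5 ->
  (forall p, F < p < F.+1 + k -> C p = zero5) ->
  (forall p, F.+1 + k <= p -> C p = C0 p) ->
  (forall p, C' p = if p == F then (b1, b2, b (F.+1 + k), b (F.+1 + k).+1, b (F.+1 + k).+2)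
     else if F.+1 + k <= p < F.+1 + k + 3 then zero5 else C p) ->
  reach (fixed F) (conf5 (Gather2 b1 b2) (F.+1 + k) C) (conf5 Front F.+1 C').
Proof.
move=> HC CF Cz C1 HC'; set s := F.+1 + k in Cz C1 HC' *.
pose G j p := if s <= p < s + j then zero5 else C p.
have HG j p : p < F -> G j p = packed p.
  by move=> pF; rewrite /G leqNgt (_ : p < s) ?HC //; lia.
have GS j p : G j.+1 p = if p == s + j then zero5 else G j p.
  rewrite /G; case: eqP => [->|ne]; first by rewrite (_ : _ && _) //; lia.
  by rewrite (_ : (s <= p < s + j.+1) = (s <= p < s + j)) //; lia.
have Gj j : G j (s + j) = C0 (s + j).
  by rewrite /G ltnn andbF C1 // leq_addr.
have G0 : C =1 G 0 by move=> p; rewrite /G addn0; case: ifP => //; lia.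
rewrite (conf5_eq _ _ G0).
apply: reach_step; first by apply: fixedE => // p; apply: HG.
have -> : step (conf5 (Gather2 b1 b2) s (G 0)) = conf5 (Gather3 b1 b2 (b s)) (s + 1) (G 1).
  apply: (@step5 _ _ _ _ zero5 true); first by rewrite -{1}[s]addn0 Gj /= addn0.
    by rewrite addn1.
  by move=> n; rewrite GS addn0.
apply: reach_step; first by apply: fixedE => // p; apply: HG.
have -> : step (conf5 (Gather3 b1 b2 (b s)) (s + 1) (G 1)) =
    conf5 (Gather4 b1 b2 (b s) (b s.+1)) (s + 2) (G 2).
  apply: (@step5 _ _ _ _ zero5 true); [by rewrite Gj /= addn1|lia|exact: GS].
apply: reach_step; first by apply: fixedE => // p; apply: HG.
have -> : step (conf5 (Gather4 b1 b2 (b s) (b s.+1)) (s + 2) (G 2)) =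
    conf5 (Back b1 b2 (b s) (b s.+1) (b s.+2)) (F + (k + 2)) (G 3).
  apply: (@step5 _ _ _ _ zero5 false); [by rewrite Gj /= addn2|rewrite /s; lia|exact: GS].
apply: reach_trans.
  apply: walk_back => [p|p hp]; first exact: HG.
  by rewrite /G; case: ifP => // hs; apply: Cz; lia.
apply: reach_step; first by apply: fixedE => // p; apply: HG.
rewrite (_ : step _ = conf5 Front F.+1 C'); first exact: reach_refl.
apply: (@step5 _ _ _ _ (b1, b2, b s, b s.+1, b s.+2) true) => //.
by rewrite /G leqNgt (_ : F < s) ?CF //; lia.
Qed.

(** The first [m] packed columns hold the pad cell and [5 * m - 1] output bits, one for each column
    read and erased. *)
Let D m p := if p < m then packed p else if p < (5 * m).-1 then zero5 else C0 p.
Let stage m := conf5 Front m.+1 (D m.+1).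

Let stage0 : reach (fixed 0) (step (conf5 (Run5 (mhalt N)) 0 C0)) (stage 0).
Proof.
rewrite (_ : step _ = conf5 (Gather2 false (b 0)) 1 (fun n => if n == 0 then front5 else C0 n)).
  2: by apply: (@step5 _ _ _ _ front5 true) => //=; rewrite eqxx.
apply: (@gather 0 _ 0) => //.
- by move=> p; lia.
- by case.
- by move=> [|[|[|[|p]]]].
Qed.

Let stageS m : seg (fixed m.+1) (stage m) (stage m.+1).
Proof.
have Dlt p : p < m.+1 -> D m.+1 p = packed p by rewrite /D => ->.
pose D1 p := if p == m.+1 then front5 else D m.+1 p.
have D1lt p : p < m.+1 -> D1 p = packed p.
  by move=> pm; rewrite /D1 (ltn_eqF pm) Dlt.
apply: (@seg_reach _ _ _ _ (conf5 Forward m.+2 D1)).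
  rewrite -(@step5 Front m.+1 (D m.+1) Forward front5 true) //; last by case: (D m.+1 m.+1) => [[[[]]]].
  by apply: seg_step; apply: fixedE.
(* The number of erased columns between the new front marker and the first unread column. *)
pose k := (5 * m.+1).-1 - m.+2.
have ks : m.+2 + k = (5 * m.+1).-1 by rewrite /k; lia.
apply: reach_trans; first apply: (walk_forward (k := k)) => //.
  move=> p hp; rewrite /D1 /D.
  have -> : (p == m.+1) = false by lia.
  have -> : (p < m.+1) = false by lia.
  by have -> : p < (5 * m.+1).-1 by lia.
apply: reach_step; first by apply: fixedE.
have D1s p : m.+2 + k <= p -> D1 p = C0 p.
  move=> hp; rewrite /D1 /D.
  have -> : (p == m.+1) = false by lia.
  have -> : (p < m.+1) = false by lia.
  by have -> : (p < (5 * m.+1).-1) = false by lia.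
pose D2 p := if p == m.+2 + k then zero5 else D1 p.
pose D3 p := if p == (m.+2 + k).+1 then zero5 else D2 p.
have -> : step (conf5 Forward (m.+2 + k) D1) = conf5 (Gather1 (b (m.+2 + k))) (m.+2 + k).+1 D2.
  by apply: (@step5 _ _ _ _ zero5 true) => //; rewrite D1s.
apply: reach_step.
  by apply: fixedE => // p pm; rewrite /D2 (_ : (p == _) = false) ?D1lt //; lia.
have -> : step (conf5 (Gather1 (b (m.+2 + k))) (m.+2 + k).+1 D2) =
    conf5 (Gather2 (b (m.+2 + k)) (b (m.+2 + k).+1)) (m.+2 + k.+2) D3.
  apply: (@step5 _ _ _ _ zero5 true) => //; last by rewrite !addnS.
  by rewrite /D2 (gtn_eqF (ltnSn _)) D1s.
have D3lo p : p < m.+2 + k -> D3 p = D1 p.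
  move=> hp; rewrite /D3 /D2; have -> : (p == (m.+2 + k).+1) = false by lia.
  by have -> : (p == m.+2 + k) = false by lia.
have D3mid p : m.+1 < p < m.+2 + k.+2 -> D3 p = zero5.
  move=> hp; rewrite /D3; case: eqP => // h1; rewrite /D2; case: eqP => // h2; rewrite /D1 /D.
  have -> : (p == m.+1) = false by lia.
  have -> : (p < m.+1) = false by lia.
  by have -> : p < (5 * m.+1).-1 by lia.
have D3hi p : m.+2 + k.+2 <= p -> D3 p = C0 p.
  move=> hp; rewrite /D3 /D2; have -> : (p == (m.+2 + k).+1) = false by lia.
  have -> : (p == m.+2 + k) = false by lia.
  by apply: D1s; lia.
apply: gather.
- by move=> p pm; rewrite D3lo ?D1lt //; lia.
- by rewrite D3lo /D1 ?eqxx //; lia.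
- exact: D3mid.
- exact: D3hi.
- move=> p; rewrite {1}/D; case: (ltngtP p m.+1) => hp.
  + rewrite ltnS (ltnW hp) D3lo ?D1lt //; last by lia.
    by case: ifP => //; lia.
  + have -> : (p < m.+2) = false by lia.
    case: ifP => h1.
      by case: ifP => // h2; rewrite D3mid //; lia.
    case: ifP => // h2; first lia.
    by rewrite D3hi //; lia.
  + rewrite hp ltnSn /expanded /=; do !congr (_, _); congr b; lia.
Qed.

(** The head first walks left to the marked column 0. The segment starts one step late because, when
    [N] halts at a limit stage, the simulation is in [Lim5] and agrees with [Run5 (mhalt N)] only
    from the next configuration on. *)
Lemma compress h :
  seg running (step (conf5 (Run5 (mhalt N)) h C0)) (conf5 Lim5 0 packed).
Proof.
have fr F c : fixed F c -> running c by case.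
apply: (@reach_seg _ _ _ _ (step (conf5 (Run5 (mhalt N)) 0 C0))).
  elim: h => [|h IH]; first exact: reach_refl.
  have -> : step (conf5 (Run5 (mhalt N)) h.+1 C0) = conf5 (Run5 (mhalt N)) h C0.
    apply: (@step5 _ _ _ _ (C0 h.+1) false) => //=; first by rewrite eqxx.
    by move=> n; case: (n =P h.+1) => [->|].
  exact: reach_step.
apply: (@reach_seg _ _ _ _ (stage 0)).
  by have [W [r [t [h1 h2 h3]]]] := stage0; exists W, r, t; split=> // i /h3/fr.
apply: (limit5 stageS) => [n c /fr //|p].
by exists p => n c pn [_ H] i; apply: H.
Qed.
End Compress.

Let simV (b : bool) x k : (b -> at_limit x) -> running x -> k < 1 ->
  running (iter k (@step _ machine5) (enc5 b x)) /\
  forall i n, ctape (iter k (@step _ machine5) (enc5 b x)) i n = true ->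
    ctape (enc5 b x) i n = true \/ ctape (enc5 false (step x)) i n = true.
Proof. by case: k => // _ _ _; split; [case: b|left]. Qed.

Lemma halts5 a xf : halting_run (ittm3_start N a) xf ->
  halting_run (conf5 Seek 0 (expanded a 0)) (conf5 Halt5 0 (expanded (ctape xf t2) 0)).
Proof.
move=> hr; have hf : cstate xf = mhalt N by case/halting_runP: hr.
have [b bl re] := sim_halts (erefl : 0 < 1) erefl erefl sim5 simV hr.
apply/halting_runP; split=> //; apply/reachE; right.
apply: seg_reach (start5 a) _; apply: reach_trans re _.
apply: reach_step; first by case: (b).
rewrite enc5_limit // enc5E hf; apply/reachE; right.
apply: seg_trans (compress _ _ _ _) _.
(* The packed output has 0 in the pad cell, so [Lim5] halts. *)
rewrite (_ : conf5 Halt5 0 _ = step (conf5 Lim5 0 (expanded (ctape xf t2) 0))); first exact: seg_step.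
by symmetry; apply: (@step5 _ _ _ _ (expanded (ctape xf t2) 0 0) false) => // -[].
Qed.

Lemma halts5_inv a : (exists e, halting_run (conf5 Seek 0 (expanded a 0)) e) ->
  exists e, halting_run (ittm3_start N a) e.
Proof.
move=> /(halts_prefix (start5 a)).
exact: (sim_halts_inv (erefl : 0 < 1) erefl erefl sim5 simV).
Qed.
End FiveTracks.

(** * From five tracks to the pad machine, and the equivalence *)

Lemma expanded_cells a p :
  col5 (expanded a 0 (p %/ 5)) (p %% 5) = if p < 1 then false else a (p - 1).
Proof.
have := divn_eq p 5; have := ltn_pmod p (isT : 0 < 5).
move: (p %/ 5) (p %% 5) => k i; rewrite /expanded ltn0 muln0 subn0.
case: i => [|[|[|[|[|//]]]]] _ -> /=.
- case: k => [//|k]; have -> : (k.+1 * 5 + 0 < 1) = false by lia.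
  by congr a; lia.
- have -> : (k * 5 + 1 < 1) = false by lia.
  by congr a; lia.
- have -> : (k * 5 + 2 < 1) = false by lia.
  by congr a; lia.
- have -> : (k * 5 + 3 < 1) = false by lia.
  by congr a; lia.
- have -> : (k * 5 + 4 < 1) = false by lia.
  by congr a; lia.
Qed.

Lemma ittm_pad f : ittm_computable f -> pad_computable 1 f.
Proof.
move=> [N HN]; exists (block_machine (machine5 N)) => a.
have cellE s h C i p : ctape (enc (@bsrc 4) (@best 4 (machine5 N)) (@bhd 4) false (conf5 s h C)) i p
    = col5 (C (p %/ 5)) (p %% 5).
  rewrite -[LHS]/(col5 (C (p %/ 5)) (inord (p %% 5) : 'I_5)).
  by rewrite inordK // ltn_pmod.
have -> : pad_start 1 (block_machine (machine5 N)) a =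
    enc (@bsrc 4) (@best 4 (machine5 N)) (@bhd 4) false (conf5 (Seek N) 0 (expanded a 0)).
  apply: config_eq => // i p; rewrite [RHS]cellE expanded_cells //.
move: (HN a); case: (f a) => [b [xf [hr xb]]|no].
  eexists; split; first exact: block_halts (halts5 hr).
  move=> n.
  by rewrite [LHS]cellE expanded_cells addn1 subn1 -xb.
by move=> /block_halts_inv/halts5_inv.
Qed.

Theorem mainTheorem11 (f : pfun) : ittm_computable f <-> pad_computable 1 f.
Proof. by split; [exact: ittm_pad|exact: pad_ittm]. Qed.
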